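(* Let $(X,Y)$ be a pair of finite simplicial complexes with a good open cover $\mathcal U$ and let $\Gamma:=\pi_1(X)$ and $\Lambda:=\pi_1(Y)$. With the maps $\boldsymbol\alpha,\boldsymbol\beta$ and the constants $C_{10},C_{11}$ (depending only on $\mathcal U$) described in the context, the following hold. 1. For $\mathfrak v,\mathfrak v'\in \mathrm{Bdl}^{\varepsilon,\mathcal U}_{P,Q}(X,Y)_T$, we have $d(\boldsymbol\alpha(\mathfrak v),\boldsymbol\alpha(\mathfrak v'))\le d(\mathfrak v,\mathfrak v')+C_{10}\varepsilon$ and $d(\boldsymbol\beta\circ\boldsymbol\alpha(\mathfrak v),\mathfrak v)\le C_{11}\varepsilon$. 2. For $\boldsymbol\pi,\boldsymbol\pi'\in\mathrm{qRep}^{\varepsilon,\mathcal G}_{P,Q}(\Gamma,\Lambda)$, we have $d(\boldsymbol\beta(\boldsymbol\pi),\boldsymbol\beta(\boldsymbol\pi'))\le d(\boldsymbol\pi,\boldsymbol\pi')+C_{10}\varepsilon$ and $d(\boldsymbol\alpha\circ\boldsymbol\beta(\boldsymbol\pi),\boldsymbol\pi)\le C_{11}\varepsilon$.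
   Context: $P,Q$ are finitely generated projective Hilbert modules over a unital C*-algebra $A$; $X,Y$ are connected. **Covers.** $\mathcal U=\{U_\mu\}_{\mu\in I}$ is a finite good open cover of $X$ such that $\mathcal U|_Y=\{U_\mu\cap Y\}_{\mu\in I_Y}$, $I_Y=\{\mu:U_\mu\cap Y\ne\emptyset\}$, is a good open cover of $Y$ (good: nonempty finite intersections are contractible). $U_{\mu\nu}=U_\mu\cap U_\nu$. Points $x_{\mu\nu}=x_{\nu\mu}\in U_{\mu\nu}$ are fixed when $U_{\mu\nu}\neq\emptyset$ (likewise for $\mathcal U|_Y$), as are continuous functions $\eta_\mu\ge0$ supported in $U_\mu$ with $\sum_\mu\eta_\mu^2=1$. **Flat bundles.** $\mathrm{Bdl}_P^{\varepsilon,\mathcal U}(X)$ is the set of $\mathrm U(P)$-valued Čech 1-cocycles $\mathbf v=\{v_{\mu\nu}\}$ on $\mathcal U$ with $\|v_{\mu\nu}(x)-v_{\mu\nu}(y)\|<\varepsilon$ for all $x,y\in U_{\mu\nu}$. $\operatorname{Hom}_\varepsilon(\mathbf v^1,\mathbf v^2)$ is the set of $\mathbf u=\{u_\mu\}\in\mathrm U(P)^I$ with $\sup_{\mu,\nu}\sup_{x\in U_{\mu\nu}}\|u_\mu v^1_{\mu\nu}(x)u_\nu^*-v^2_{\mu\nu}(x)\|<\varepsilon$. $\mathrm{Bdl}^{\varepsilon,\mathcal U}_{P,Q}(X,Y)$ is the set of quadruples $\mathfrak v=(\mathbf v_1,\mathbf v_2,\mathbf v_0,\mathbf u)$ with $\mathbf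 v_1,\mathbf v_2\in\mathrm{Bdl}_P^{\varepsilon,\mathcal U}(X)$, $\mathbf v_0\in \mathrm{Bdl}_Q^{\varepsilon,\mathcal U|_Y}(Y)$ and $\mathbf u=\{u_\mu\}_{\mu\in I_Y}\in\operatorname{Hom}_\varepsilon(\mathbf v_1|_Y\oplus\mathbf v_0,\mathbf v_2|_Y\oplus\mathbf v_0)$. **Tree and generators.** $N_{\mathcal U}$ is the nerve of $\mathcal U$; $\langle\mu,\nu\rangle$ is its edge directed from $\nu$ to $\mu$. $T$ is a fixed maximal subtree of $N_{\mathcal U}^{(1)}$ such that $T\cap N_{\mathcal U|_Y}^{(1)}$ is a maximal subtree of $N_{\mathcal U|_Y}^{(1)}$; $\mu_0\in I_Y$ is fixed; $\ell_\mu$ is the minimal path in $T$ from $\mu_0$ to $\mu$. $\Gamma$ and $\Lambda$ are identified with the fundamental groups of the nerves based at $\mu_0$; $\phi\colon\Lambda\to\Gamma$ is induced by the inclusion. $\gamma_{\mu\nu}:=[\ell_\mu^{-1}\circ\langle\mu,\nu\rangle\circ\ell_\nu]\in\Gamma$ (which is $e$ if $\mu=\nu$ or $\langle\mu,\nu\rangle\in T$); $\mathcal G_\Gamma=\{\gamma_{\mu\nu}:\langle\mu,\nu\rangle\in N_{\mathcal U}^{(1)}\setminus T\}$, $\mathcal G_\Lambda\subset\Lambda$ is defined likewise from $\mathcal U|_Y$, and $\mathcal G=(\mathcal G_\Gamma,\mathcal G_\Lambda)$. $\mathbf v$ is normalized on $T$ if $\|v_{\mu\nu}(x)-1\|<\varepsilon$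 for all $\langle\mu,\nu\rangle\in T$; the subscript $T$ denotes the subset of quadruples with $\mathbf v_1,\mathbf v_2,\mathbf v_0$ normalized on $T$. **Quasi-representations.** An $(\varepsilon,\mathcal G_\Gamma)$-representation of $\Gamma$ on $P$ is a map $\pi\colon\Gamma\to\mathrm U(P)$ with $\pi(e)=1$ and $\|\pi(g)\pi(h)-\pi(gh)\|<\varepsilon$ for $g,h\in\mathcal G_\Gamma$ (likewise for $\Lambda$). $\operatorname{Hom}_\varepsilon(\pi_1,\pi_2)$ is the set of unitaries $u$ with $\|u\pi_1(\gamma)u^*-\pi_2(\gamma)\|<\varepsilon$ for all group elements $\gamma$. $\mathrm{qRep}^{\varepsilon,\mathcal G}_{P,Q}(\Gamma,\Lambda)$ is the set of quadruples $\boldsymbol\pi=(\pi_1,\pi_2,\pi_0,u)$ with $\pi_1,\pi_2$ $(\varepsilon,\mathcal G_\Gamma)$-representations of $\Gamma$ on $P$, $\pi_0$ an $(\varepsilon,\mathcal G_\Lambda)$-representation of $\Lambda$ on $Q$ and $u\in\operatorname{Hom}_\varepsilon(\pi_1\circ\phi\oplus\pi_0,\pi_2\circ\phi\oplus\pi_0)$. **The map $\alpha$.** Let $\mathbb F$ be the free group generated by the symbols $s_{\mu\nu}$, $\langle\mu,\nu\rangle\in N^{(1)}_{\mathcal U}\setminus T$ (with $s_{\nu\mu}=s_{\mu\nu}^{-1}$), and fix a set-theoretic section $\tau\colon\Gamma\to\mathbb F$ of $s_{\mu\nu}\mapsto\gamma_{\mu\nu}$ with $\tau(e)=e$ and $\tau(\gamma_{\mu\nu})=s_{\mu\nu}$.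 For $\mathbf v$ normalized on $T$ and $\ell_\mu$ passing through $\mu_0,\mu_1,\dots,\mu_k=\mu$, put $w_\mu=v_{\mu_k\mu_{k-1}}(x_{\mu_k\mu_{k-1}})\cdots v_{\mu_1\mu_0}(x_{\mu_1\mu_0})$. Then $\alpha(\mathbf v)\colon\Gamma\to\mathrm U(P)$ is $\tau$ followed by the homomorphism $s_{\mu\nu}\mapsto w_\mu^*v_{\mu\nu}(x_{\mu\nu})w_\nu$; it is a $(C_9\varepsilon,\mathcal G_\Gamma)$-representation for a constant $C_9$ depending only on $\mathcal U$. The same construction is used on $Y$. **The map $\beta$.** For an $(\varepsilon,\mathcal G_\Gamma)$-representation $\pi$ of $\Gamma$ on $P$, let $\breve\psi_\mu^\pi=\sum_\nu\eta_\nu\otimes\pi(\gamma_{\nu\mu})\otimes e_\nu$, regarded over $U_\mu$ as a function with values in operators $P\to P\otimes\mathbb C^I$ ($\{e_\nu\}$ the standard basis of $\mathbb C^I$), and $$v^\pi_{\mu\nu}=((\breve\psi^\pi_\mu)^*\breve\psi^\pi_\mu)^{-1/2}\,(\breve\psi^\pi_\mu)^*\breve\psi^\pi_\nu\,((\breve\psi^\pi_\nu)^*\breve\psi^\pi_\nu)^{-1/2},\qquad \beta(\pi):=\{v^\pi_{\mu\nu}\}.$$ It is asserted that $\|v^\pi_{\mu\nu}(x)-\pi(\gamma_{\mu\nu})\|<4\varepsilon$ and that $\beta(\pi)$ is an $(8\varepsilon,\mathcal U)$-flat bundle normalized on $T$. The same construction is used on $Y$. **The maps $\boldsymbol\alpha,\boldsymbol\beta$.**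 There are constants $C_{10},C_{11}>0$ depending only on $\mathcal U$ ($C_{10}$ controls the analogous estimates for $\alpha,\beta$; $C_{11}$ is such that $\alpha$ and $\beta$ carry $\varepsilon$-morphisms to $C_{11}\varepsilon$-morphisms). With $C_{12}=\max\{C_9,8,C_{11}\}$, the maps $$\boldsymbol\alpha\colon \mathrm{Bdl}^{\varepsilon,\mathcal U}_{P,Q}(X,Y)_T\to \mathrm{qRep}^{C_{12}\varepsilon,\mathcal G}_{P,Q}(\Gamma,\Lambda),\qquad \boldsymbol\beta\colon \mathrm{qRep}^{\varepsilon,\mathcal G}_{P,Q}(\Gamma,\Lambda)\to\mathrm{Bdl}^{C_{12}\varepsilon,\mathcal U}_{P,Q}(X,Y)_T$$ are defined by $\boldsymbol\alpha(\mathbf v_1,\mathbf v_2,\mathbf v_0,\mathbf u)=(\alpha(\mathbf v_1),\alpha(\mathbf v_2),\alpha(\mathbf v_0),u_{\mu_0})$ and $\boldsymbol\beta(\pi_1,\pi_2,\pi_0,u)=(\beta(\pi_1),\beta(\pi_2),\beta(\pi_0),\Delta(u))$, where $\Delta(u)$ is the constant family with value $u$. **Distances.** $d(\mathbf v,\mathbf v')=\sup_{\mu,\nu}\|v_{\mu\nu}-v'_{\mu\nu}\|$ (sup norm); $d(\pi,\pi')=\sup_\gamma\|\pi(\gamma)-\pi'(\gamma)\|$ over $\gamma\in\mathcal G_\Gamma$ (resp. $\mathcal G_\Lambda$); $d(\mathbf u,\mathbf u')=\sup_\mu\|u_\mu-u_\mu'\|$, $d(u,u')=\|u-u'\|$;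 on quadruples $d$ is the maximum of the four component distances.
   Formalization: The maps α, β are taken by their formulas on all quadruples, since their asserted codomains fail (β(π) need not be unitary); the section τ need only send each nontrivial generator to some s_{μν} representing it, as τ(γ_{μν})=s_{μν} for all edges is inconsistent. *)

(* Defs.v *)
From HB Require Import structures.
From Stdlib Require Import Relation_Operators.
From mathcomp Require Import all_boot all_order all_algebra generic_quotient.
From mathcomp.real_closed Require Import complex.
From mathcomp Require Import all_classical all_reals.
From mathcomp Require Import ereal topology normedtype.

Set Implicit Arguments.
Unset Strict Implicit.
Unset Printing Implicit Defensive.

Import Order.TTheory GRing.Theory Num.Theory.
Import numFieldNormedType.Exports.
Local Open Scope classical_set_scope.
Local Open Scope ring_scope.
Local Open Scope complex_scope.
Local Open Scope quotient_scope.

Definition seq_complete (R : realType) (V : zmodType) (nu : V -> R) : Prop :=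
  forall u : nat -> V,
    (forall e : R, 0 < e -> exists N : nat, forall m n : nat,
       (N <= m)%N -> (N <= n)%N -> nu (u m - u n) < e) ->
  exists l : V, forall e : R, 0 < e -> exists N : nat, forall n : nat,
    (N <= n)%N -> nu (u n - l) < e.

HB.mixin Record isCStar (R : realType) (A : Type) of GRing.Algebra R[i] A := {
  star : A -> A;
  cnorm : A -> R;
  starK : involutive star;
  starD : {morph star : a b / a + b};
  starZ : forall (c : R[i]) (a : A), star (c *: a) = c^* *: star a;
  starM : forall a b : A, star (a * b) = star b * star a;
  cnormD : forall a b : A, cnorm (a + b) <= cnorm a + cnorm b;
  cnormZ : forall (c : R[i]) (a : A),
    cnorm (c *: a) = complex.Re `|c| * cnorm a;
  cnorm_eq0 : forall a : A, cnorm a = 0 -> a = 0;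
  cnormM : forall a b : A, cnorm (a * b) <= cnorm a * cnorm b;
  cnorm_star : forall a : A, cnorm (star a * a) = cnorm a ^+ 2;
  cstar_complete : seq_complete cnorm
}.

#[short(type="cstarType")]
HB.structure Definition CStar (R : realType) :=
  {A of GRing.Algebra R[i] A & isCStar R A}.

Definition cpos (R : realType) (A : cstarType R) (a : A) : Prop :=
  exists b : A, a = star b * b.

(* A right [A]-module is a left module over the converse ring [A^c]: the
   element [x . a] is [(a : A^c) *: x].  Complex scalars act through
   [c |-> c *: 1]. *)
HB.mixin Record isInnerMod (R : realType) (A : cstarType R) (E : Type)
    of GRing.Lmodule A^c E := {
  inner : E -> E -> A;
  innerC : forall x y : E, star (inner x y) = inner y x;
  innerDr : forall x y z : E, inner x (y + z) = inner x y + inner x z;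
  innerZr : forall (x y : E) (a : A),
    inner x ((a : A^c) *: y) = inner x y * a
}.

#[short(type="innerModType")]
HB.structure Definition InnerMod (R : realType) (A : cstarType R) :=
  {E of GRing.Lmodule A^c E & isInnerMod R A E}.

Definition rscale (R : realType) (A : cstarType R) (E : innerModType A)
  (r : R) (x : E) : E := ((r%:C *: (1 : A) : A) : A^c) *: x.

Definition hnorm (R : realType) (A : cstarType R) (E : innerModType A)
  (x : E) : R := Num.sqrt (cnorm (inner x x)).

HB.mixin Record isHilbertMod (R : realType) (A : cstarType R) (E : Type)
    of InnerMod R A E := {
  inner_pos : forall x : E, cpos (inner x x);
  inner_def : forall x : E, inner x x = 0 -> x = 0;
  hilbert_complete : seq_complete (@hnorm R A E)
}.

#[short(type="hilbertModType")]
HB.structure Definition HilbertMod (R : realType) (A : cstarType R) :=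
  {E of InnerMod R A E & isHilbertMod R A E}.

(* [E] is a retract of the free right module [A^n]. *)
Definition fg_projective (R : realType) (A : cstarType R)
    (E : hilbertModType A) : Prop :=
  exists (n : nat) (i : {linear E -> {ffun 'I_n -> A^c^o}})
         (r : {linear {ffun 'I_n -> A^c^o} -> E}), cancel i r.

Section InnerModTheory.
Variables (R : realType) (A : cstarType R).

Lemma star0 : star (0 : A) = 0.
Proof. by apply: (addIr (star (0 : A))); rewrite -starD !add0r. Qed.

Lemma starN (a : A) : star (- a) = - star a.
Proof. by apply: (addIr (star a)); rewrite -starD !addNr star0. Qed.

Lemma star_real (r : R) : star (r%:C *: (1 : A)) = r%:C *: 1.
Proof.
rewrite starZ; congr (_ *: _); first exact: conjc_real.
by rewrite -[RHS]starK -[in RHS](mulr1 (star 1)) starM starK mulr1.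
Qed.

Variable E : innerModType A.
Implicit Types x y z : E.

Lemma innerDl x y z : inner (x + y) z = inner x z + inner y z.
Proof. by rewrite -innerC innerDr starD !innerC. Qed.

Lemma inner0r x : inner x 0 = 0.
Proof. by apply: (addIr (inner x 0)); rewrite -innerDr !add0r. Qed.

Lemma inner0l x : inner 0 x = 0.
Proof. by rewrite -innerC inner0r star0. Qed.

Lemma innerNr x y : inner x (- y) = - inner x y.
Proof. by apply: (addIr (inner x y)); rewrite -innerDr !addNr inner0r. Qed.

Lemma innerNl x y : inner (- x) y = - inner x y.
Proof. by rewrite -innerC innerNr starN innerC. Qed.

Lemma innerZl x y (a : A) : inner ((a : A^c) *: x) y = star a * inner x y.
Proof. by rewrite -innerC innerZr starM innerC. Qed.

Lemma inner_suml (I : Type) (s : seq I) (F : I -> E) y :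
  inner (\sum_(i <- s) F i) y = \sum_(i <- s) inner (F i) y.
Proof.
by elim/big_rec2: _ => [|i a x _ <-]; rewrite ?inner0l ?innerDl.
Qed.

Lemma inner_sumr (I : Type) (s : seq I) (F : I -> E) y :
  inner y (\sum_(i <- s) F i) = \sum_(i <- s) inner y (F i).
Proof.
by elim/big_rec2: _ => [|i a x _ <-]; rewrite ?inner0r ?innerDr.
Qed.

Lemma inner_rscale (r : R) x y : inner (rscale r x) y = inner x (rscale r y).
Proof.
rewrite /rscale innerZl innerZr star_real.
by rewrite -scalerAl mul1r -scalerAr mulr1.
Qed.
End InnerModTheory.

(* The direct sum of two modules and the tensor product [E (x) C^I], the
   latter as the module of [I]-tuples of elements of [E]. *)
Section Sums.
Variables (R : realType) (A : cstarType R).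

Section Pair.
Variables E F : innerModType A.
Definition pair_inner (x y : E * F) : A := inner x.1 y.1 + inner x.2 y.2.

Fact pair_innerC x y : star (pair_inner x y) = pair_inner y x.
Proof. by rewrite /pair_inner starD !innerC. Qed.

Fact pair_innerDr x y z :
  pair_inner x (y + z) = pair_inner x y + pair_inner x z.
Proof. by rewrite /pair_inner !innerDr addrACA. Qed.

Fact pair_innerZr x y (a : A) :
  pair_inner x ((a : A^c) *: y) = pair_inner x y * a.
Proof. by rewrite /pair_inner !innerZr mulrDl. Qed.

HB.instance Definition _ := isInnerMod.Build R A (E * F)%type
  pair_innerC pair_innerDr pair_innerZr.
End Pair.

Section Ffun.
Variables (I : finType) (E : innerModType A).
Definition ffun_inner (x y : {ffun I -> E}) : A := \sum_i inner (x i) (y i).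

Fact ffun_innerC x y : star (ffun_inner x y) = ffun_inner y x.
Proof.
rewrite /ffun_inner; elim/big_rec2: _ => [|i a b _ <-]; first exact: star0.
by rewrite starD innerC.
Qed.

Fact ffun_innerDr x y z :
  ffun_inner x (y + z) = ffun_inner x y + ffun_inner x z.
Proof.
by rewrite -big_split; apply: eq_bigr => i _; rewrite ffunE innerDr.
Qed.

Fact ffun_innerZr x y (a : A) :
  ffun_inner x ((a : A^c) *: y) = ffun_inner x y * a.
Proof. by rewrite mulr_suml; apply: eq_bigr => i _; rewrite ffunE innerZr. Qed.

HB.instance Definition _ := isInnerMod.Build R A {ffun I -> E}
  ffun_innerC ffun_innerDr ffun_innerZr.
End Ffun.
End Sums.

(* On Hilbert modules an adjointable map is automatically A-linear and
   bounded, and its adjoint is unique. *)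
Record adjop (R : realType) (A : cstarType R) (E F : innerModType A) := Adjop {
  opfun :> E -> F;
  opadj : F -> E;
  opadjP : forall x y, inner (opfun x) y = inner x (opadj y)
}.

Section AdjopZmod.
Variables (R : realType) (A : cstarType R) (E F : innerModType A).
Implicit Types S T : adjop E F.

Lemma adjop_eq S T : opfun S =1 opfun T -> opadj S =1 opadj T -> S = T.
Proof.
case: S T => [f f' hf] [g g' hg] /= /funext efg /funext efg'.
by move: hf hg; rewrite efg efg' => hf hg; congr Adjop; exact: Prop_irrelevance.
Qed.

HB.instance Definition _ := gen_eqMixin (adjop E F).
HB.instance Definition _ := gen_choiceMixin (adjop E F).

Fact op0_adj (x : E) (y : F) : inner (0 : F) y = inner x (0 : E).
Proof. by rewrite inner0l inner0r. Qed.
Definition op0 : adjop E F := Adjop op0_adj.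

Fact opD_adj S T x y :
  inner (S x + T x) y = inner x (opadj S y + opadj T y).
Proof. by rewrite innerDl innerDr !opadjP. Qed.
Definition opD S T : adjop E F := Adjop (opD_adj S T).

Fact opN_adj S x y : inner (- S x) y = inner x (- opadj S y).
Proof. by rewrite innerNl innerNr opadjP. Qed.
Definition opN S : adjop E F := Adjop (opN_adj S).

Fact opDA : associative opD.
Proof. by move=> S T U; apply: adjop_eq => x /=; rewrite addrA. Qed.
Fact opDC : commutative opD.
Proof. by move=> S T; apply: adjop_eq => x /=; rewrite addrC. Qed.
Fact op0D : left_id op0 opD.
Proof. by move=> S; apply: adjop_eq => x /=; rewrite add0r. Qed.
Fact opND : left_inverse op0 opN opD.
Proof. by move=> S; apply: adjop_eq => x /=; rewrite addNr. Qed.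

HB.instance Definition _ :=
  GRing.isZmodule.Build (adjop E F) opDA opDC op0D opND.
End AdjopZmod.

Section Operators.
Variables (R : realType) (A : cstarType R).
Implicit Types E F G : innerModType A.

Fact adj_adj E F (T : adjop E F) x y : inner (opadj T x) y = inner x (T y).
Proof. by rewrite -innerC -opadjP innerC. Qed.
Definition adj E F (T : adjop E F) : adjop F E := Adjop (adj_adj T).

Fact opcomp_adj E F G (S : adjop F G) (T : adjop E F) x y :
  inner (S (T x)) y = inner x (opadj T (opadj S y)).
Proof. by rewrite !opadjP. Qed.
Definition opcomp E F G (S : adjop F G) (T : adjop E F) : adjop E G :=
  Adjop (opcomp_adj S T).

Fact op1_adj E (x y : E) : inner (id x) y = inner x (id y).
Proof. by []. Qed.
Definition op1 E : adjop E E := Adjop (@op1_adj E).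

(* The operator norm, with value [+oo] if the operator is unbounded. *)
Definition opnorm E F (T : adjop E F) : \bar R :=
  ereal_sup [set (hnorm (T x))%:E | x in [set x : E | hnorm x <= 1]].

Fact opsum_adj E F (S : adjop E E) (T : adjop F F) (x y : E * F) :
  inner ((S x.1, T x.2) : E * F) y =
  inner x ((opadj S y.1, opadj T y.2) : E * F).
Proof. by rewrite /inner /= /pair_inner /= !opadjP. Qed.
Definition opsum E F (S : adjop E E) (T : adjop F F) :
  adjop (E * F)%type (E * F)%type := Adjop (opsum_adj S T).

(* The operator [x |-> \sum_i c_i . T_i x (x) e_i] from [E] to [E (x) C^I]. *)
Fact opcol_adj (I : finType) E (c : I -> R) (T : I -> adjop E E) x y :
  inner ([ffun i => rscale (c i) (T i x)] : {ffun I -> E}) y =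
  inner x (\sum_i opadj (T i) (rscale (c i) (y i))).
Proof.
rewrite inner_sumr [LHS]/inner /= /ffun_inner; apply: eq_bigr => i _.
by rewrite ffunE inner_rscale opadjP.
Qed.
Definition opcol (I : finType) E (c : I -> R) (T : I -> adjop E E) :
  adjop E {ffun I -> E} := Adjop (opcol_adj c T).
End Operators.

Arguments opnorm {R A E F} T%_R.

Section OpMonoid.
Variables (R : realType) (A : cstarType R) (E : innerModType A).

Fact opcompA : associative (@opcomp R A E E E).
Proof. by move=> S T U; apply: adjop_eq. Qed.
Fact op1M : left_id (op1 E) (@opcomp R A E E E).
Proof. by move=> S; apply: adjop_eq. Qed.
Fact opM1 : right_id (op1 E) (@opcomp R A E E E).
Proof. by move=> S; apply: adjop_eq. Qed.

HB.instance Definition _ :=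
  Monoid.isLaw.Build (adjop E E) (op1 E) (@opcomp R A E E E)
    opcompA op1M opM1.
End OpMonoid.

Notation "S ** T" := (opcomp S T) (at level 40, left associativity).
Notation "T ^adj" := (adj T) (at level 2, format "T ^adj").

Definition unitary (R : realType) (A : cstarType R) (E : innerModType A)
  (u : adjop E E) : Prop := u^adj ** u = op1 E /\ u ** u^adj = op1 E.

(* [T^(-1/2)]: the positive square root of the inverse of [T], and [0] if
   there is none. *)
Definition inv_sqrt (R : realType) (A : cstarType R) (E : innerModType A)
    (T : adjop E E) : adjop E E :=
  xget 0 [set S | [/\ exists B : adjop E E, S = B^adj ** B,
                      S ** S ** T = op1 E & T ** (S ** S) = op1 E]].

Section EdgePath.
Variables (I : finType) (N : {set {set I}}) (m0 : I).

Definition edge : rel I := fun a b => (a == b) || ([set a; b] \in N)%SET.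

(* [p] lists the vertices met after [m0] by a closed edge path at [m0]. *)
Definition is_loop (p : seq I) : bool := path edge m0 p && (last m0 p == m0).

Definition loop := {p : seq I | is_loop p}.
HB.instance Definition _ := Choice.on loop.

(* Elementary homotopies [a a -> a], and [a b c -> a c] when [{a, b, c}] is a
   simplex. *)
Definition elem_homotopy (p q : loop) : Prop :=
  (exists (s t : seq I) (a : I),
     m0 :: val p = s ++ [:: a, a & t] /\ m0 :: val q = s ++ a :: t) \/
  (exists (s t : seq I) (a b c : I),
     [/\ ([set a; b; c] \in N)%SET, m0 :: val p = s ++ [:: a, b, c & t]
       & m0 :: val q = s ++ [:: a, c & t]]).

Definition homotopic : loop -> loop -> Prop :=
  clos_refl_sym_trans loop elem_homotopy.

Definition homotopicb : rel loop := fun p q => `[< homotopic p q >].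

Fact homotopicb_refl : reflexive homotopicb.
Proof. by move=> p; apply/asboolP; apply: rst_refl. Qed.
Fact homotopicb_sym : symmetric homotopicb.
Proof.
by move=> p q; apply/asboolP/asboolP; apply: rst_sym.
Qed.
Fact homotopicb_trans : transitive homotopicb.
Proof.
move=> q p r /asboolP h /asboolP h'; apply/asboolP.
exact: rst_trans h h'.
Qed.

Canonical homotopic_equiv :=
  EquivRel homotopicb homotopicb_refl homotopicb_sym homotopicb_trans.

Definition pi1 := {eq_quot homotopicb}.
HB.instance Definition _ := Choice.on pi1.
HB.instance Definition _ := EqQuotient.on pi1.

Fact loop_id_subproof : is_loop [::].
Proof. by rewrite /is_loop /= eqxx. Qed.
Definition loop_id : loop := Sub [::] loop_id_subproof.

Fact loop_cat_subproof (p q : loop) : is_loop (val p ++ val q).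
Proof.
case: p q => [p /andP[p1 /eqP p2]] [q /andP[q1 q2]] /=.
by rewrite /is_loop cat_path last_cat p1 p2 q1.
Qed.
Definition loop_cat (p q : loop) : loop := Sub _ (loop_cat_subproof p q).

Lemma edge_sym : symmetric edge.
Proof. by move=> a b; rewrite /edge /= eq_sym finset.setUC. Qed.

Lemma path_back (p : seq I) :
  path edge m0 p -> path edge (last m0 p) (rev (belast m0 p)).
Proof.
by rewrite rev_path (eq_path (e' := edge)) // => a b; exact: edge_sym.
Qed.

Lemma last_back (a b : I) (p : seq I) :
  last b (rev (belast a p)) = if p is [::] then b else a.
Proof. by case: p => // c p; rewrite /= rev_cons last_rcons. Qed.

Fact loop_rev_subproof (p : loop) : is_loop (rev (belast m0 (val p))).
Proof.
case: p => [p /andP[p1 /eqP p2]] /=; rewrite /is_loop -{1}p2 path_back //=.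
by rewrite last_back; case: p p1 p2.
Qed.
Definition loop_rev (p : loop) : loop := Sub _ (loop_rev_subproof p).

Lemma homotopic_catr (r p q : loop) :
  homotopic p q -> homotopic (loop_cat p r) (loop_cat q r).
Proof.
elim=> [{}p {}q h|*|*|{}p {}q u _ h _ h']; [|exact: rst_refl|exact: rst_sym
  |exact: rst_trans h h'].
apply: rst_step.
case: h => [[s [t [a [hp hq]]]]|[s [t [a [b [c [hN hp hq]]]]]]].
  left; exists s, (t ++ val r), a => /=.
  by rewrite -!cat_cons hp hq -!catA.
right; exists s, (t ++ val r), a, b, c => /=.
by split=> //; rewrite -!cat_cons ?hp ?hq -!catA.
Qed.

Lemma homotopic_catl (r p q : loop) :
  homotopic p q -> homotopic (loop_cat r p) (loop_cat r q).
Proof.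
have rE (u : seq I) : m0 :: val r ++ u = belast m0 (val r) ++ m0 :: u.
  case: r => r /= /andP[_ /eqP r2].
  by rewrite -cat_cons lastI r2 cat_rcons.
elim=> [{}p {}q h|*|*|{}p {}q u _ h _ h']; [|exact: rst_refl|exact: rst_sym
  |exact: rst_trans h h'].
apply: rst_step.
case: h => [[s [t [a [hp hq]]]]|[s [t [a [b [c [hN hp hq]]]]]]].
  left; exists (belast m0 (val r) ++ s), t, a => /=.
  by rewrite !rE hp hq -!catA.
right; exists (belast m0 (val r) ++ s), t, a, b, c => /=.
by split=> //; rewrite !rE ?hp ?hq -!catA.
Qed.

Lemma homotopic_back (p : loop) (s : seq I) : path edge m0 s ->
  val p = s ++ rev (belast m0 s) -> homotopic p loop_id.
Proof.
elim/last_ind: s p => [|s x IH] p.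
  by move=> _ hp; have -> : p = loop_id by [apply: val_inj];  apply: rst_refl.
rewrite rcons_path => /andP[hs hx].
rewrite belast_rcons lastI rev_rcons cat_rcons => hp.
set y := last m0 s in hx hp.
have q_loop : is_loop (s ++ rev (belast m0 s)).
  rewrite /is_loop cat_path hs (path_back hs) last_cat last_back.
  by case: (s) => [|? ?]; rewrite /= eqxx.
have q'_loop : is_loop (s ++ y :: rev (belast m0 s)).
  rewrite /is_loop cat_path hs /= last_cat /= last_back -/y.
  rewrite (path_back hs) [edge y y]/edge eqxx /y.
  by case: (s) => [|? ?]; rewrite /= eqxx.
have sE (u : seq I) : m0 :: s ++ u = belast m0 s ++ y :: u.
  by rewrite -cat_cons lastI cat_rcons.
apply: rst_trans (IH (Sub _ q_loop) hs erefl).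
apply: (@rst_trans _ _ _ (Sub _ q'_loop)); apply: rst_step; last first.
  left; exists (belast m0 s), (rev (belast m0 s)), y => /=.
  by rewrite !sE.
move: hx; rewrite /edge /=; have [yx _|_ /= hN] := eqVneq y x.
  left; exists (belast m0 s), (y :: rev (belast m0 s)), y => /=.
  by rewrite hp !sE -yx.
right; exists (belast m0 s), (rev (belast m0 s)), y, x, y => /=.
by rewrite hp !sE; split=> //; rewrite finset.setUC finset.setUA finset.setUid.
Qed.

(* Classes of paths multiply like maps: in [g * h] the path [h] is run
   through first. *)
Definition pi1_one : pi1 := \pi_pi1 loop_id.
Definition pi1_mul (g h : pi1) : pi1 := \pi_pi1 (loop_cat (repr h) (repr g)).
Definition pi1_inv (g : pi1) : pi1 := \pi_pi1 (loop_rev (repr g)).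

Lemma pi1_eqP (p q : loop) : reflect (homotopic p q) (\pi_pi1 p == \pi_pi1 q).
Proof. by rewrite piE; exact: asboolP. Qed.

Lemma pi1_mulE (p q : loop) :
  pi1_mul (\pi_pi1 p) (\pi_pi1 q) = \pi_pi1 (loop_cat q p).
Proof.
apply/eqP/pi1_eqP.
have reprP u : homotopic (repr (\pi_pi1 u)) u by apply/pi1_eqP; rewrite reprK.
apply: rst_trans (homotopic_catr _ (reprP q)).
exact: homotopic_catl (reprP p).
Qed.

Fact pi1_mulA : associative pi1_mul.
Proof.
elim/quotW=> f; elim/quotW=> g; elim/quotW=> h.
rewrite (pi1_mulE g h) (pi1_mulE f g) !pi1_mulE.
by congr (\pi_pi1 _); apply: val_inj; rewrite /= catA.
Qed.

Fact pi1_mul1g : left_id pi1_one pi1_mul.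
Proof.
elim/quotW=> g; rewrite pi1_mulE; congr (\pi_pi1 _).
by apply: val_inj; rewrite /= cats0.
Qed.

Fact pi1_mulg1 : right_id pi1_one pi1_mul.
Proof.
by elim/quotW=> g; rewrite pi1_mulE; congr (\pi_pi1 _); apply: val_inj.
Qed.

Fact pi1_mulVg : left_inverse pi1_one pi1_inv pi1_mul.
Proof.
move=> g; rewrite /pi1_inv -[in X in pi1_mul _ X](reprK g) pi1_mulE.
apply/eqP/pi1_eqP; apply: (homotopic_back (s := val (repr g))) => //.
by case: (repr g) => p /= /andP[].
Qed.

Fact pi1_mulgV : right_inverse pi1_one pi1_inv pi1_mul.
Proof.
move=> g; rewrite /pi1_inv -[in X in pi1_mul X _](reprK g) pi1_mulE.
apply/eqP/pi1_eqP; case: (repr g) => p p_loop.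
have /andP[p1 /eqP p2] := p_loop.
apply: (homotopic_back (s := rev (belast m0 p))) => /=.
  by rewrite -{1}p2 path_back.
congr (_ ++ _); case: p {p_loop} p1 p2 => // a p _ p2.
rewrite [belast m0 (a :: p)]/= rev_cons belast_rcons rev_cons revK.
by rewrite lastI -p2 /=.
Qed.

HB.instance Definition _ := isGroup.Build pi1
  pi1_mulA pi1_mul1g pi1_mulg1 pi1_mulVg pi1_mulgV.
End EdgePath.

(* The map induced by an inclusion [N' \subset N]; well defined since
   homotopic loops of [N'] are homotopic in [N]. *)
Definition pi1_incl (I : finType) (N' N : {set {set I}}) (m0 : I)
    (g : pi1 N' m0) : pi1 N m0 :=
  \pi_(pi1 N m0) (insubd (loop_id N m0) (val (repr g))).

Definition simplicial_complex (V : finType) (K : {set {set V}}) : Prop :=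
  finset.set0 \notin K /\
  (forall S S' : {set V}, S \in K -> S' \subset S -> S' != finset.set0 ->
     S' \in K).

(* Points are given by their barycentric coordinates. *)
Definition realization (R : realType) (n : nat) (K : {set {set 'I_n}}) :
    set 'rV[R]_n :=
  [set x : 'rV[R]_n | [/\ forall i, 0 <= x 0 i, \sum_i x 0 i = 1
             & [set i | x 0 i != 0]%SET \in K]].
Arguments realization R {n} K _.

Definition contractible (R : realType) (T : topologicalType) (S : set T) :
    Prop :=
  exists (x0 : T) (H : R * T -> T),
    [/\ S x0,
        {within `[0, 1]%classic `*` S, continuous H},
        forall t x, 0 <= t <= 1 -> S x -> S (H (t, x)),
        forall x, S x -> H (0, x) = x
      & forall x, S x -> H (1, x) = x0].

Section Covers.
Variables (R : realType) (T : topologicalType) (I : finType).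
Implicit Types (X Y : set T) (U : I -> set T).

Definition inter U (S : {set I}) : set T := \bigcap_(m in [set` S]) U m.

(* Members of a cover may be empty, so that the restriction to [Y] can keep
   the index type [I]; an empty member is not a vertex of the nerve. *)
Definition good_open_cover X U : Prop :=
  [/\ forall m, exists2 O, open O & U m = X `&` O,
      X = \bigcup_m U m
    & forall S : {set I}, S != finset.set0 -> inter U S !=set0 ->
        contractible R (inter U S)].

Definition restricted_cover U Y : I -> set T := fun m => U m `&` Y.

Definition nerve U : {set {set I}} :=
  [set S : {set I} | (S != finset.set0) && `[< inter U S !=set0 >]]%SET.

Definition chosen_points U (pt : I -> I -> T) : Prop :=
  forall m n, U m `&` U n !=set0 -> pt m n = pt n m /\ (U m `&` U n) (pt m n).

Definition square_partition X U (eta : I -> T -> R) : Prop :=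
  [/\ forall m, {within X, continuous (eta m)},
      forall m x, X x -> 0 <= eta m x,
      forall m, X `&` closure (X `&` [set x | eta m x != 0]) `<=` U m
    & forall x, X x -> \sum_m eta m x ^+ 2 = 1].
End Covers.

(* Graphs are simplicial complexes of dimension at most one. *)
Section Trees.
Variable I : finType.
Implicit Types N G T : {set {set I}}.

Definition skel1 N : {set {set I}} := [set S in N | (#|S| <= 2)%N]%SET.

Definition adjacent G : rel I := fun a b => (a != b) && ([set a; b]%SET \in G).

Definition is_tree T : Prop :=
  [/\ simplicial_complex T, T != finset.set0,
      forall S, S \in T -> (#|S| <= 2)%N,
      forall a b, [set a]%SET \in T -> [set b]%SET \in T ->
        connect (adjacent T) a b
    & forall c : seq I, ucycle (adjacent T) c -> (size c <= 2)%N].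

Definition maximal_subtree G T : Prop :=
  [/\ is_tree T, T \subset G
    & forall T' : {set {set I}},
        is_tree T' -> T' \subset G -> T \subset T' -> T' = T].

(* Paths are given by the vertices that follow [m0]. *)
Definition minimal_path T (m0 : I) (m : I) (p : seq I) : Prop :=
  [/\ path (adjacent T) m0 p, last m0 p = m
    & forall q, path (adjacent T) m0 q -> last m0 q = m ->
        (size p <= size q)%N].

Definition tree_path T (m0 : I) (m : I) : seq I :=
  xget [::] [set p | minimal_path T m0 m p].

(* [gamma N T m0 m n] is the class of the loop that follows the tree from
   [m0] to [n], crosses the edge from [n] to [m] and returns to [m0] along the
   tree.  [insubd] only matters if [n] and [m] do not span a simplex. *)
Definition gamma N T (m0 : I) (m n : I) : pi1 N m0 :=
  \pi_(pi1 N m0) (insubd (loop_id N m0)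
    (tree_path T m0 n ++ m :: rev (belast m0 (tree_path T m0 m)))).

(* The directed edges [(m, n)] of [N] from [n] to [m] that are not in [T]. *)
Definition off_tree N T : pred (I * I) :=
  fun e => adjacent N e.1 e.2 && ([set e.1; e.2]%SET \notin T).

Definition generators N T (m0 : I) : set (pi1 N m0) :=
  [set g | exists2 e, off_tree N T e & g = gamma N T m0 e.1 e.2].
Arguments generators : clear implicits.

(* The free group on the symbols [s_e], [e] a directed edge outside [T], with
   [s_(n,m) = s_(m,n)^-1]: its elements are the reduced words. *)
Definition is_reduced N T (w : seq (I * I)) : bool :=
  all (off_tree N T) w && sorted (fun e e' => e' != (e.2, e.1)) w.
Definition free_group N T := {w : seq (I * I) | is_reduced N T w}.

Definition free_to_pi1 N T (m0 : I) (w : free_group N T) : pi1 N m0 :=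
  \big[*%g/1%g]_(e <- val w) gamma N T m0 e.1 e.2.

(* Distinct edges may have the same class [gamma], and that class may be
   trivial; so for every nontrivial generator [g] the section picks one of the
   symbols [s_e] with [gamma_e = g]. *)
Definition good_section N T (m0 : I) (tau : pi1 N m0 -> free_group N T) :
    Prop :=
  [/\ forall g, free_to_pi1 m0 (tau g) = g,
      val (tau 1%g) = [::]
    & forall g, generators N T m0 g -> g <> 1%g ->
        exists e, [/\ off_tree N T e, gamma N T m0 e.1 e.2 = g
                    & val (tau g) = [:: e]]].
End Trees.

Arguments generators {I} N T m0 _.

Section BundlesAndReps.
Variables (R : realType) (A : cstarType R) (T : topologicalType) (I : finType).
Implicit Types (E : innerModType A) (U : I -> set T).
Implicit Types N G : {set {set I}}.

(* Only the values of [v m n] on [U m `&` U n] are relevant. *)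
Definition cochain E := I -> I -> T -> adjop E E.

Definition sup_norm (S : set (\bar R)) : \bar R := ereal_sup (0%E |` S).

Definition dist_cochain U E (v v' : cochain E) : \bar R :=
  sup_norm [set r | exists m n x,
    (U m `&` U n) x /\ r = opnorm (v m n x - v' m n x)].

Definition flat_bundle U E (eps : R) (v : cochain E) : Prop :=
  [/\ forall m n x, (U m `&` U n) x -> unitary (v m n x),
      forall m n k x, U m x -> U n x -> U k x ->
        v m n x ** v n k x = v m k x,
      forall m n x, (U m `&` U n) x -> forall e : R, 0 < e ->
        \forall y \near within (U m `&` U n) (nbhs x),
          (opnorm (v m n y - v m n x) < e%:E)%E
    & forall m n x y, (U m `&` U n) x -> (U m `&` U n) y ->
        (opnorm (v m n x - v m n y) < eps%:E)%E].

Definition normalized U G E (eps : R) (v : cochain E) : Prop :=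
  forall m n x, adjacent G m n -> (U m `&` U n) x ->
    (opnorm (v m n x - op1 E) < eps%:E)%E.

Definition bundle_hom U E (eps : R) (v1 v2 : cochain E) (u : I -> adjop E E) :
    Prop :=
  (forall m, U m !=set0 -> unitary (u m)) /\
  (sup_norm [set r | exists m n x, (U m `&` U n) x /\
     r = opnorm (u m ** v1 m n x ** (u n)^adj - v2 m n x)] < eps%:E)%E.

Definition quasi_rep N G (m0 : I) E (eps : R)
    (rho : pi1 N m0 -> adjop E E) : Prop :=
  [/\ forall g, unitary (rho g),
      rho 1%g = op1 E
    & forall g h, generators N G m0 g -> generators N G m0 h ->
        (opnorm (rho g ** rho h - rho (g * h)%g) < eps%:E)%E].

Definition rep_hom (Gam : Type) E (eps : R) (rho1 rho2 : Gam -> adjop E E)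
    (u : adjop E E) : Prop :=
  unitary u /\
  forall g, (opnorm (u ** rho1 g ** u^adj - rho2 g) < eps%:E)%E.

Definition dist_rep N G (m0 : I) E (rho rho' : pi1 N m0 -> adjop E E) :
    \bar R :=
  sup_norm [set opnorm (rho g - rho' g) | g in generators N G m0].

(* [v_(m_k, m_(k-1)) ... v_(m_1, a)] along [p = m_1 ... m_k]. *)
Fixpoint transport (pt : I -> I -> T) E (v : cochain E) (a : I) (p : seq I) :
    adjop E E :=
  if p is b :: q then transport pt v b q ** v b a (pt b a) else op1 E.

(* Since [v_(n,m) = (v_(m,n))^*], letters of both orientations are evaluated
   by the same formula. *)
Definition alpha N G (m0 : I) (pt : I -> I -> T)
    (tau : pi1 N m0 -> free_group N G) E (v : cochain E) (g : pi1 N m0) :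
    adjop E E :=
  let w m := transport pt v m0 (tree_path G m0 m) in
  \big[@opcomp R A E E E/op1 E]_(e <- val (tau g))
    ((w e.1)^adj ** v e.1 e.2 (pt e.1 e.2) ** w e.2).

Definition psi N G (m0 : I) (eta : I -> T -> R) E (rho : pi1 N m0 -> adjop E E)
    (m : I) (x : T) : adjop E {ffun I -> E} :=
  opcol (eta^~ x) (fun k => rho (gamma N G m0 k m)).

Definition beta N G (m0 : I) (eta : I -> T -> R) E
    (rho : pi1 N m0 -> adjop E E) :
    cochain E :=
  fun m n x =>
    let p k := psi G eta rho k x in
    inv_sqrt ((p m)^adj ** p m) ** ((p m)^adj ** p n) **
    inv_sqrt ((p n)^adj ** p n).
End BundlesAndReps.

Section Relative.
Variables (R : realType) (A : cstarType R) (T : topologicalType) (I : finType).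
Variables (P Q : hilbertModType A).

Record rel_bundle := RelBundle {
  bun1 : cochain T I P;
  bun2 : cochain T I P;
  bun0 : cochain T I Q;
  bunu : I -> adjop (P * Q)%type (P * Q)%type
}.

Record rel_rep (Gam Lam : Type) := RelRep {
  rep1 : Gam -> adjop P P;
  rep2 : Gam -> adjop P P;
  rep0 : Lam -> adjop Q Q;
  repu : adjop (P * Q)%type (P * Q)%type
}.

Variables (U : I -> set T) (Y : set T) (G : {set {set I}}) (m0 : I).
Let V := restricted_cover U Y.
Let N := nerve U.
Let M := nerve V.
Let GY := G :&: skel1 M.

Definition bun_sum (v : cochain T I P) (v0 : cochain T I Q) :
    cochain T I (P * Q)%type := fun m n x => opsum (v m n x) (v0 m n x).

Definition Bdl (eps : R) (b : rel_bundle) : Prop :=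
  [/\ flat_bundle U eps (bun1 b) /\ normalized U G eps (bun1 b),
      flat_bundle U eps (bun2 b) /\ normalized U G eps (bun2 b),
      flat_bundle V eps (bun0 b) /\ normalized V GY eps (bun0 b)
    & bundle_hom V eps (bun_sum (bun1 b) (bun0 b))
        (bun_sum (bun2 b) (bun0 b)) (bunu b)].

Definition qRep (eps : R) (r : rel_rep (pi1 N m0) (pi1 M m0)) : Prop :=
  let phi := @pi1_incl I M N m0 in
  [/\ quasi_rep G eps (rep1 r),
      quasi_rep G eps (rep2 r),
      quasi_rep GY eps (rep0 r)
    & rep_hom eps (fun g => opsum (rep1 r (phi g)) (rep0 r g))
        (fun g => opsum (rep2 r (phi g)) (rep0 r g)) (repu r)].

Definition dist_bundle (b b' : rel_bundle) : \bar R :=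
  maxe (maxe (dist_cochain U (bun1 b) (bun1 b'))
             (dist_cochain U (bun2 b) (bun2 b')))
       (maxe (dist_cochain V (bun0 b) (bun0 b'))
             (sup_norm [set opnorm (bunu b m - bunu b' m)
                       | m in [set m | V m !=set0]])).

Definition dist_rel_rep (r r' : rel_rep (pi1 N m0) (pi1 M m0)) : \bar R :=
  maxe (maxe (dist_rep G (rep1 r) (rep1 r'))
             (dist_rep G (rep2 r) (rep2 r')))
       (maxe (dist_rep GY (rep0 r) (rep0 r')) (opnorm (repu r - repu r'))).

Definition rel_alpha (ptX ptY : I -> I -> T)
    (tauX : pi1 N m0 -> free_group N G) (tauY : pi1 M m0 -> free_group M GY)
    (b : rel_bundle) : rel_rep (pi1 N m0) (pi1 M m0) :=
  RelRep (alpha ptX tauX (bun1 b)) (alpha ptX tauX (bun2 b))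
         (alpha ptY tauY (bun0 b)) (bunu b m0).

Definition rel_beta (eta : I -> T -> R)
    (r : rel_rep (pi1 N m0) (pi1 M m0)) : rel_bundle :=
  RelBundle (beta G eta (rep1 r)) (beta G eta (rep2 r))
            (beta GY eta (rep0 r)) (fun=> repu r).
End Relative.

(* Main.v *)
From Stdlib Require Import Relation_Operators.
From mathcomp Require Import generic_quotient sequences ring lra zify.
Require Import Defs.
From mathcomp Require Import all_boot all_order all_algebra.
From mathcomp.real_closed Require Import complex.
From mathcomp Require Import all_classical all_reals.
From mathcomp Require Import ereal topology normedtype.

Set Implicit Arguments.
Unset Strict Implicit.
Unset Printing Implicit Defensive.

Import Order.TTheory GRing.Theory Num.Theory.
Import numFieldNormedType.Exports.
Local Open Scope classical_set_scope.
Local Open Scope ring_scope.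

(* For a unitary-valued representation the columns psi_m are isometric, so beta
   involves no inverse square root and beta(rho)_(m,n)(x) is the average of
   rho(g_(k,m))^* rho(g_(k,n)) with weights eta_k(x)^2 over the k with x in U_k.
   For a quasi-representation each term is eps-close to rho(g_(m,n)).  For
   rho = alpha(v) only the values rho(g_(m,n)) occur, and these are close to
   v_(m,n): the transport of v along a loop changes by at most 3 eps under an
   elementary homotopy, it is close to v_(m,n) along the loop of g_(m,n), and
   for all pairs of such loops that are homotopic the number of elementary
   homotopies is bounded in terms of the cover.  The norm estimates rest on the
   Cauchy-Schwarz inequality in Hilbert modules, hence on the positivity of b* b
   in a C*-algebra, proved with the binomial series of the square root. *)

(** * Positivity in C*-algebras *)

(** The constants have to precede the tree, the base point, the sample points, the sections and the
    C*-algebra. Hence the number of elementary homotopies is bounded over all candidate trees, base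
    points and pairs of edges at once, of which there are finitely many. Homotopies enter because
    distinct edges may have the same class, or a trivial one: the section [tau] then evaluates
    [alpha] at one edge, while the bundle has to be recovered at another. The estimates hold for
    every [eps > 0], small or not: the factors of the products are contractions, so that errors add
    up without being amplified. For the same reason [alpha] can be estimated on [beta] of a
    quasi-representation from two facts only, that the values are contractions and that they are
    close to 1 along the tree. The fourth components need an argument of their own, since [beta]
    after [alpha] replaces a family of unitaries by its value at [m0]; closeness to 1 along the tree
    makes such a family almost constant. *)

Section CStarNorm.
Variables (R : realType) (A : cstarType R).
Implicit Types (a b c h k x : A) (r s t e : R).
Local Notation "r *:: a" := ((real_complex R r) *: a) (at level 40).

Lemma cnormZr r a : cnorm (r *:: a) = `|r| * cnorm a.
Proof. by rewrite cnormZ normc_def /= expr0n /= addr0 sqrtr_sqr. Qed.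

Lemma cnorm0 : cnorm (0 : A) = 0.
Proof. by rewrite -(scale0r (0 : A)) -(rmorph0 (real_complex R)) cnormZr
  normr0 mul0r. Qed.

Lemma cnormN a : cnorm (- a) = cnorm a.
Proof. by rewrite -scaleN1r -(rmorphN1 (real_complex R)) cnormZr normrN1
  mul1r. Qed.

Lemma cnorm_ge0 a : 0 <= cnorm a.
Proof. by have := cnormD a (- a); rewrite subrr cnorm0 cnormN; lra. Qed.

Lemma cnormB a b : cnorm (a - b) = cnorm (b - a).
Proof. by rewrite -cnormN opprB. Qed.

Lemma starB a b : star (a - b) = star a - star b.
Proof. by rewrite starD starN. Qed.

Lemma star1 : star (1 : A) = 1.
Proof. by rewrite -[LHS]mulr1 -[X in _ * X]starK -starM mulr1 starK. Qed.

Lemma starZr r a : star (r *:: a) = r *:: star a.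
Proof. by rewrite starZ; congr (_ *: _); exact: conjc_real. Qed.

Lemma starZi a : star (('i%C : R[i]) *: a) = - (('i%C : R[i]) *: star a).
Proof.
rewrite starZ -scaleNr; congr (_ *: _).
by apply/eqP; rewrite eq_complex /= oppr0 !eqxx.
Qed.

Lemma le_cnorm_star a : cnorm a <= cnorm (star a).
Proof.
have := cnormM (star a) a; rewrite cnorm_star expr2.
have [->|a0] := eqVneq (cnorm a) 0; first by rewrite cnorm_ge0.
by rewrite ler_pM2r // lt_neqAle eq_sym a0 cnorm_ge0.
Qed.

Lemma cnorm_starE a : cnorm (star a) = cnorm a.
Proof.
by apply/eqP; rewrite eq_le le_cnorm_star -{2}(starK a) le_cnorm_star.
Qed.

Lemma cnorm_sqr h : star h = h -> cnorm (h * h) = cnorm h ^+ 2.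
Proof. by move=> hh; rewrite -cnorm_star hh. Qed.

Lemma cnorm_sa_nilpotent h : star h = h -> h * h = 0 -> h = 0.
Proof.
move=> hs h0; apply: cnorm_eq0; apply/eqP.
by rewrite -sqrf_eq0 -cnorm_sqr // h0 cnorm0.
Qed.

(** The C*-identity makes [cnorm 1] a nonzero idempotent number, hence 1, and then gives
    [cnorm u ^+ 2 = 1]. *)
Lemma cnorm_star1 u : star u * u = 1 -> cnorm (u : A) = 1.
Proof.
move=> uu; have := cnorm_star u; have := cnorm_star (1 : A).
rewrite uu star1 mulr1.
have /eqP := oner_neq0 A; have := cnorm_ge0 u; have := @cnorm_eq0 _ A 1.
have := cnorm_ge0 (1 : A).
move: (cnorm u) (cnorm 1) => p q q0 h p0 n1 e1 e2.
have /eqP : q * (q - 1) = 0 by lra.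
rewrite mulf_eq0 => /orP[/eqP/h//|/eqP q1].
have /eqP : (p - 1) * (p + 1) = 0 by lra.
by rewrite mulf_eq0 => /orP[] /eqP; lra.
Qed.

Definition clim (u : nat -> A) (l : A) : Prop := forall e, 0 < e ->
  exists N : nat, forall n : nat, (N <= n)%N -> cnorm (u n - l) < e.

Lemma cnorm_eq0_lt a : (forall e, 0 < e -> cnorm a < e) -> a = 0.
Proof.
move=> ae; apply: cnorm_eq0; apply/eqP; have := cnorm_ge0 a.
rewrite le_eqVlt => /orP[/eqP <-//|a_gt0].
by have := ae _ a_gt0; rewrite ltxx.
Qed.

Lemma clim_uniq u l l' : clim u l -> clim u l' -> l = l'.
Proof.
move=> ul ul'; apply/eqP; rewrite -subr_eq0; apply/eqP/cnorm_eq0_lt => e e0.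
have [N hN] := ul (e / 2) ltac:(lra); have [N' hN'] := ul' (e / 2) ltac:(lra).
have := hN (maxn N N') (leq_maxl _ _); have := hN' (maxn N N') (leq_maxr _ _).
set m := maxn _ _ => h1 h2.
have -> : l - l' = (u m - l') + - (u m - l)
  by rewrite opprB [RHS]addrC addrA subrK.
by apply: le_lt_trans (cnormD _ _) _; rewrite cnormN; lra.
Qed.

Lemma clim_dominated (u v : nat -> A) l l' r : 0 < r ->
  (forall n, cnorm (v n - l') <= r * cnorm (u n - l)) -> clim u l -> clim v l'.
Proof.
move=> r0 uv ul e e0; have [N hN] := ul (e / r) (divr_gt0 e0 r0).
exists N => n /hN; rewrite ltr_pdivlMr // mulrC; exact: le_lt_trans.
Qed.

Lemma climD u v l k : clim u l -> clim v k -> clim (fun n => u n + v n) (l + k).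
Proof.
move=> ul vk e e0.
have [N hN] := ul (e / 2) ltac:(lra); have [N' hN'] := vk (e / 2) ltac:(lra).
exists (maxn N N') => n; rewrite geq_max => /andP[/hN h1 /hN' h2].
by rewrite opprD addrACA; apply: le_lt_trans (cnormD _ _) _; lra.
Qed.

Lemma clim_cst c : clim (fun=> c) c.
Proof. by move=> e e0; exists 0%N => n _; rewrite subrr cnorm0. Qed.

Lemma climZ r u l : clim u l -> clim (fun n => r *:: u n) (r *:: l).
Proof.
apply: (@clim_dominated _ _ _ _ (`|r| + 1)) => [|n].
  by rewrite ltr_pwDr.
by rewrite -scalerBr cnormZr mulrDl mul1r lerDl cnorm_ge0.
Qed.

Lemma climMl c u l : clim u l -> clim (fun n => c * u n) (c * l).
Proof.
apply: (@clim_dominated _ _ _ _ (cnorm c + 1)) => [|n].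
  by rewrite ltr_pwDr ?cnorm_ge0.
by rewrite -mulrBr (le_trans (cnormM _ _)) // mulrDl mul1r lerDl cnorm_ge0.
Qed.

Lemma climMr c u l : clim u l -> clim (fun n => u n * c) (l * c).
Proof.
apply: (@clim_dominated _ _ _ _ (cnorm c + 1)) => [|n].
  by rewrite ltr_pwDr ?cnorm_ge0.
rewrite -mulrBl (le_trans (cnormM _ _)) //.
by rewrite mulrC mulrDl mul1r lerDl cnorm_ge0.
Qed.

Lemma clim_star u l : clim u l -> clim (fun n => star (u n)) (star l).
Proof.
apply: (@clim_dominated _ _ _ _ 1) => // n.
by rewrite -starB cnorm_starE mul1r.
Qed.

Lemma clim_shift u l : clim u l -> clim (fun n => u n.+1) l.
Proof.
by move=> ul e /ul[N hN]; exists N => n Nn; apply: hN; exact: leqW.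
Qed.

Lemma clim_norm_le u l r : (forall n, cnorm (u n) <= r) -> clim u l ->
  cnorm l <= r.
Proof.
move=> ur ul; apply/ler_addgt0Pr => e /ul[N /(_ N (leqnn N))].
have := cnormD (u N) (- (u N - l)); rewrite cnormN opprB addrC subrK.
by have := ur N; lra.
Qed.

(* [y_n] is a polynomial in [x] with nonnegative coefficients and increases to
   [1 - sqrt (1 - x)]; the sequence with [x] replaced by the number [|x|]
   dominates its increments. *)
Fixpoint yseq x (n : nat) : A :=
  if n is m.+1 then 2^-1 *:: (x + yseq x m * yseq x m) else 0.

Fixpoint tseq r (n : nat) : R :=
  if n is m.+1 then 2^-1 * (r + tseq r m * tseq r m) else 0.

Lemma tseq_bound r n : 0 <= r <= 1 -> 0 <= tseq r n <= 1.
Proof. by move=> r01; elim: n => [|n IH] /=; [lra|nra]. Qed.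

Lemma tseqS r n : 0 <= r <= 1 -> tseq r n <= tseq r n.+1.
Proof.
move=> r01; elim: n => [|n IH]; first by have /andP[] := tseq_bound 1 r01.
have e1 : tseq r n.+1 = 2^-1 * (r + tseq r n * tseq r n) by [].
have e2 : tseq r n.+2 = 2^-1 * (r + tseq r n.+1 * tseq r n.+1) by [].
rewrite e2 [leLHS]e1.
by have := tseq_bound n r01; have := tseq_bound n.+1 r01; nra.
Qed.

Lemma yseq_bound x r n : cnorm x <= r -> r <= 1 -> cnorm (yseq x n) <= tseq r n.
Proof.
move=> xr r1; have r0 := le_trans (cnorm_ge0 x) xr.
elim: n => [|n IH] /=; first by rewrite cnorm0.
rewrite cnormZr ger0_norm ?invr_ge0 // ler_wpM2l ?invr_ge0 //.
apply: le_trans (cnormD _ _) _; apply: lerD => //.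
apply: le_trans (cnormM _ _) _.
by apply: ler_pM => //; exact: cnorm_ge0.
Qed.

Lemma yseq_incr x r n : cnorm x <= r -> r <= 1 ->
  cnorm (yseq x n.+1 - yseq x n) <= tseq r n.+1 - tseq r n.
Proof.
move=> xr r1; have r0 := le_trans (cnorm_ge0 x) xr.
elim: n => [|n IH].
  rewrite !subr0; exact: yseq_bound.
rewrite [yseq x n.+2]/= [X in cnorm (_ - X)]/= -/(yseq x n) -scalerBr cnormZr.
rewrite [tseq r n.+2]/= [X in _ <= _ - X]/= -/(tseq r n) -mulrBr.
rewrite ger0_norm ?invr_ge0 // ler_wpM2l ?invr_ge0 //.
rewrite opprD addrACA subrr add0r opprD addrACA subrr add0r.
set y' := yseq x n.+1 in IH *; set y := yseq x n in IH *.
(* This splitting holds without commutation and is dominated term by term by its scalar analogue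
   below. *)
have -> : y' * y' - y * y = y' * (y' - y) + (y' - y) * y.
  by rewrite mulrBr mulrBl addrA subrK.
have ly' : cnorm y' <= _ := yseq_bound n.+1 xr r1.
have ly : cnorm y <= _ := yseq_bound n xr r1.
set s' := tseq r n.+1 in IH ly' *; set s := tseq r n in IH ly *.
have -> : s' * s' - s * s = s' * (s' - s) + (s' - s) * s by ring.
apply: le_trans (cnormD _ _) _; apply: lerD.
  by apply: le_trans (cnormM _ _) _; apply: ler_pM => //; exact: cnorm_ge0.
by apply: le_trans (cnormM _ _) _; apply: ler_pM => //; exact: cnorm_ge0.
Qed.

Lemma yseq_dist x r m n : cnorm x <= r -> r <= 1 -> (n <= m)%N ->
  cnorm (yseq x m - yseq x n) <= tseq r m - tseq r n.
Proof.
move=> xr r1 /subnK <-; elim: (m - n)%N => [|k IH].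
  by rewrite add0n !subrr cnorm0.
rewrite addSn; set M := (k + n)%N in IH *.
have -> : yseq x M.+1 - yseq x n =
    (yseq x M.+1 - yseq x M) + (yseq x M - yseq x n).
  by rewrite addrA subrK.
by apply: le_trans (cnormD _ _) _; have := yseq_incr M xr r1; lra.
Qed.

Lemma yseq_cvg x : cnorm x <= 1 -> exists l, clim (yseq x) l.
Proof.
move=> x1; apply: cstar_complete => e e0.
have r01 : 0 <= cnorm x <= 1 by rewrite cnorm_ge0.
have tmono : {homo tseq (cnorm x) : m n / (m <= n)%N >-> m <= n}.
  by apply/nondecreasing_seqP => n; exact: tseqS.
have tcvg : cvgn (tseq (cnorm x)).
  apply: nondecreasing_is_cvgn => //.
  by exists 1 => _ [n _ <-]; have /andP[] := tseq_bound n r01.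
have /cvgrPdist_lt /(_ (e / 2) ltac:(lra)) [N _ hN] := tcvg.
exists N => m n Nm Nn.
wlog nm : m n Nm Nn / (n <= m)%N => [hw|].
  case/orP: (leq_total n m) => [|mn]; first exact: hw.
  by rewrite cnormB; exact: hw.
apply: le_lt_trans (yseq_dist (lexx _) x1 nm) _.
have /= := hN _ Nm; have /= := hN _ Nn.
by rewrite !ltr_norml => /andP[? ?] /andP[? ?]; lra.
Qed.

(** In the limit the recursion reads [l + l = x + l * l]. *)
Lemma yseq_lim_eq x l : clim (yseq x) l -> (1 - l) * (1 - l) = 1 - x.
Proof.
move=> yl; have yl' : clim (fun n => yseq x n * yseq x n) (l * l).
  move=> e e0.
  have l0 := cnorm_ge0 l; set M := cnorm l + 1.
  have [N1 h1] := yl 1 ltac:(lra).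
  have [N hN] := yl (e / (2 * M)) ltac:(rewrite divr_gt0 // /M; lra).
  exists (maxn N1 N) => n; rewrite geq_max => /andP[/h1 {}h1 /hN {}hN].
  have -> : yseq x n * yseq x n - l * l =
      yseq x n * (yseq x n - l) + (yseq x n - l) * l.
    by rewrite mulrBr mulrBl addrA subrK.
  apply: le_lt_trans (cnormD _ _) _.
  have := cnormM (yseq x n) (yseq x n - l); have := cnormM (yseq x n - l) l.
  have := cnormD (yseq x n - l) l; rewrite subrK.
  have y0 := cnorm_ge0 (yseq x n); have d0 := cnorm_ge0 (yseq x n - l).
  move: hN; rewrite ltr_pdivlMr ?mulr_gt0 // /M; try lra.
  move: (cnorm _) (cnorm _) (cnorm l) y0 d0 l0 h1 => y d p y0 d0 p0 d1.
  by move=> hd hp h2 h3; nra.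
have /(climZ (2^-1)) /= yl2 := climD (clim_cst x) yl'.
have e1 := clim_uniq (clim_shift yl) yl2.
have {e1} e2 : l + l = x + l * l.
  rewrite -mulr2n -scaler_nat [X in _ *: X]e1 scalerA.
  have -> : (2%:R : R[i]) * real_complex R (2^-1) = 1.
    by rewrite -(rmorph_nat (real_complex R)) -rmorphM /= mulfV.
  by rewrite scale1r.
rewrite mulrBr mulr1 mulrBl mul1r opprB addrA addrAC.
by rewrite -(addrA 1) -opprD e2 opprD addrA subrK.
Qed.

(** Two elements [x], [x'] are allowed because [star_mul_nonpos] needs [c] to intertwine the roots
    of two different squares. *)
Lemma yseq_comm x x' c n : x * c = c * x' -> yseq x n * c = c * yseq x' n.
Proof.
move=> xc; elim: n => [|n IH] /=; first by rewrite mul0r mulr0.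
by rewrite -scalerAl -scalerAr mulrDl mulrDr xc -mulrA IH mulrA IH mulrA.
Qed.

Lemma yseq_star x n : star x = x -> star (yseq x n) = yseq x n.
Proof.
move=> xs; elim: n => [|n IH] /=; first by rewrite star0.
by rewrite starZr starD xs starM IH.
Qed.

(* [sroot t a h]: [h] is the root of [a] given by the binomial series around
   [t]; it commutes with whatever commutes with [a]. *)
Definition sroot t a h : Prop := exists2 l,
  clim (yseq (1 - t^-1 *:: a)) l & h = Num.sqrt t *:: (1 - l).

(* Positivity as being the square of a self-adjoint element: unlike for [cpos],
   closure under sums has a direct proof. *)
Definition csq a : Prop := exists2 h, star h = h & a = h * h.

Lemma sroot_ex t a : 0 < t -> cnorm (t *:: 1 - a) <= t -> exists h, sroot t a h.
Proof.
move=> t0 ta; have [|l yl] := @yseq_cvg (1 - t^-1 *:: a); last first.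
  by exists (Num.sqrt t *:: (1 - l)), l.
have -> : 1 - t^-1 *:: a = t^-1 *:: (t *:: 1 - a).
  by rewrite scalerBr scalerA -rmorphM /= mulVf ?gt_eqF // scale1r.
by rewrite cnormZr gtr0_norm ?invr_gt0 // mulrC ler_pdivrMr // mul1r.
Qed.

Lemma sroot_sqr t a h : 0 < t -> sroot t a h -> h * h = a.
Proof.
move=> t0 [l /yseq_lim_eq yl ->]; rewrite -scalerAl -scalerAr scalerA yl.
rewrite -rmorphM /= -expr2 sqr_sqrtr ?ltW // opprB addrC subrK scalerA.
by rewrite -rmorphM /= mulfV ?gt_eqF // scale1r.
Qed.

Lemma sroot_star t a h : star a = a -> sroot t a h -> star h = h.
Proof.
move=> sa [l yl ->]; rewrite starZr starB star1; congr (_ *: (_ - _)).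
apply: (clim_uniq _ yl); have := clim_star yl.
congr (clim _ _); apply: funext => n; apply: yseq_star.
by rewrite starB starZr star1 sa.
Qed.

Lemma sroot_comm t a a' c h h' : sroot t a h -> sroot t a' h' ->
  a * c = c * a' -> h * c = c * h'.
Proof.
move=> [l yl ->] [l' yl' ->] ac; rewrite -scalerAl -scalerAr; congr (_ *: _).
rewrite mulrBl mulrBr mul1r mulr1; congr (_ - _).
apply: (clim_uniq (climMr c yl)); have := climMl c yl'.
congr (clim _ _); apply: funext => n; apply/esym/yseq_comm.
by rewrite mulrBl mulrBr mul1r mulr1 -scalerAl -scalerAr ac.
Qed.

(* [h + i k] is unitary. *)
Lemma cnorm_cos h k : star h = h -> star k = k -> h * k = k * h ->
  h * h + k * k = 1 -> cnorm h <= 1.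
Proof.
move=> sh sk hk hk1; pose u := h + ('i%C : R[i]) *: k.
have ii : ('i%C : R[i]) * 'i%C = -1 by rewrite -expr2 sqr_i.
have su : star u = h - ('i%C : R[i]) *: k.
  by rewrite starD starZi sh sk.
have uu : star u * u = 1.
  rewrite su mulrDr 2!mulrBl -!scalerAl -!scalerAr -hk scalerA ii scaleN1r.
  by rewrite opprK addrA subrK.
have /cnorm_star1 nu := uu.
have hE : h = 2^-1 *:: (u + star u).
  rewrite su addrACA subrr addr0 -mulr2n -(scaler_nat 2 h) scalerA.
  rewrite -(rmorph_nat (real_complex R)) -rmorphM /= mulVf //.
  by rewrite scale1r.
rewrite hE cnormZr ger0_norm ?invr_ge0 //.
by have := cnormD u (star u); rewrite cnorm_starE nu; lra.
Qed.

(** * Positive elements and their norms *)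

Lemma csq_star a : csq a -> star a = a.
Proof. by move=> [h hs ->]; rewrite starM hs. Qed.

Lemma csqZ r a : 0 <= r -> csq a -> csq (r *:: a).
Proof.
move=> r0 [h hs ->]; exists (Num.sqrt r *:: h); first by rewrite starZr hs.
by rewrite -scalerAl -scalerAr scalerA -rmorphM /= -[Num.sqrt r * _]expr2
  sqr_sqrtr.
Qed.

(** For [a = h * h] the series root [s] of [1 - h * h] commutes with [h], and [s * s + h * h = 1],
    so [cnorm_cos] bounds [s]. *)
Lemma csq_norm1 a : csq a -> cnorm a <= 1 -> cnorm (1 - a) <= 1.
Proof.
move=> [h hs ->] h1; have t1 : 0 < (1 : R) by [].
have hhs : star (1 - h * h) = 1 - h * h by rewrite starB star1 starM hs.
have [|s sr] := @sroot_ex 1 (1 - h * h) t1;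
  first by rewrite scale1r opprB addrC subrK.
have ss := sroot_star hhs sr.
have sh : s * h = h * s.
  by apply: (sroot_comm sr sr); rewrite mulrBl mulrBr mul1r mulr1 mulrA.
have sE := sroot_sqr t1 sr.
have := cnorm_cos ss hs sh; rewrite sE subrK => /(_ erefl) s1.
by rewrite -sE cnorm_sqr // expr_le1 // cnorm_ge0.
Qed.

Lemma csq_norm t a : 0 < t -> csq a -> cnorm a <= t -> cnorm (t *:: 1 - a) <= t.
Proof.
move=> t0 aq at'; have -> : t *:: 1 - a = t *:: (1 - t^-1 *:: a).
  by rewrite scalerBr scalerA -rmorphM /= mulfV ?gt_eqF // scale1r.
rewrite cnormZr gtr0_norm // ger_pMr //; apply: csq_norm1.
  by apply: csqZ => //; rewrite invr_ge0 ltW.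
by rewrite cnormZr gtr0_norm ?invr_gt0 // mulrC ler_pdivrMr // mul1r.
Qed.

(** Together with [csq_norm] this turns positivity into the inequality [cnorm (t - a) <= t], which
    passes to sums by the triangle inequality. *)
Lemma norm_csq t a : 0 < t -> star a = a -> cnorm (t *:: 1 - a) <= t -> csq a.
Proof.
move=> t0 sa /(sroot_ex t0)[h hr]; exists h; first exact: sroot_star hr.
by rewrite (sroot_sqr t0 hr).
Qed.

Lemma csqD a b : csq a -> csq b -> csq (a + b).
Proof.
move=> aq bq; have a0 := cnorm_ge0 a; have b0 := cnorm_ge0 b.
set t := cnorm a + cnorm b + 1.
apply: (@norm_csq (t + t)); first by rewrite /t; lra.
  by rewrite starD !csq_star.
rewrite rmorphD /= scalerDl opprD addrACA.
by apply: le_trans (cnormD _ _) _; apply: lerD; apply: csq_norm => //;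
  rewrite /t; lra.
Qed.

(** The root supplied by [csq] need not commute with what commutes with [a]; the series root does.
    In particular roots of [a] and [1 - a] can be chosen commuting, as [cnorm_cos] requires. *)
Lemma csq_comm_root a : csq a -> exists h,
  [/\ star h = h, a = h * h & forall c, a * c = c * a -> h * c = c * h].
Proof.
move=> aq; have a0 := cnorm_ge0 a; have t0 : 0 < cnorm a + 1 by lra.
have [|h hr] := sroot_ex t0 (a := a); first by apply: csq_norm => //; lra.
exists h; split; [exact: sroot_star (csq_star aq) hr| |].
  by rewrite (sroot_sqr t0 hr).
by move=> c; exact: (sroot_comm hr hr).
Qed.

Lemma csq_le1 a : csq a -> csq (1 - a) -> cnorm a <= 1.
Proof.
move=> /csq_comm_root[h [hs aE hc]] /csq_comm_root[k [ks a1E kc]].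
rewrite aE cnorm_sqr // expr_le1 ?cnorm_ge0 //.
apply: (@cnorm_cos h k) => //; last by rewrite -aE -a1E addrC subrK.
apply: hc; apply/esym/kc; rewrite mulrBl mulrBr mul1r mulr1 //.
Qed.

(** After division by some [t] slightly above [cnorm (a + b)], both [1 - (a + b)] and [b] are
    positive, hence so is their sum [1 - a], and [csq_le1] applies. The margin [e] keeps [t]
    positive. *)
Lemma csq_le_norm a b : csq a -> csq b -> cnorm a <= cnorm (a + b).
Proof.
move=> aq bq; apply/ler_addgt0Pr => e e0.
have c0 := cnorm_ge0 (a + b); set t := cnorm (a + b) + e.
have t0 : 0 < t by rewrite /t; lra.
have s0 : 0 <= t^-1 by rewrite invr_ge0 ltW.
suff : cnorm (t^-1 *:: a) <= 1.
  by rewrite cnormZr ger0_norm // mulrC ler_pdivrMr // mul1r.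
apply: csq_le1; first exact: csqZ.
have -> : 1 - t^-1 *:: a = (1 - t^-1 *:: (a + b)) + t^-1 *:: b.
  by rewrite scalerDr opprD addrA subrK.
apply: csqD; last exact: csqZ.
apply: (@norm_csq 1) => //.
  by rewrite starB starZr star1 starD !csq_star.
rewrite scale1r opprB addrC subrK cnormZr ger0_norm // mulrC ler_pdivrMr //.
by rewrite mul1r /t; lra.
Qed.

Lemma csq_addr_eq0 a b : csq a -> csq b -> a + b = 0 -> a = 0.
Proof.
move=> aq bq ab; apply: cnorm_eq0; apply/eqP; rewrite eq_le cnorm_ge0 andbT.
by have := csq_le_norm aq bq; rewrite ab cnorm0.
Qed.

Lemma csqM2 a d : csq a -> star d = d -> a * d = d * a -> csq (d * a * d).
Proof.
move=> /csq_comm_root[h [hs aE hc]] ds /hc hd.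
exists (h * d); first by rewrite starM hs ds.
by rewrite aE mulrA -hd -!mulrA.
Qed.

(** With [d := q - r], the positive elements [d * q * d] and [d * r * d] have sum 0, so both vanish;
    their difference is the cube of the self-adjoint [d], which is therefore 0. *)
Lemma csq_sqrt_uniq (q r : A) : csq q -> csq r -> q * r = r * q ->
  q * q = r * r ->
  q = r.
Proof.
move=> qq rq qr qqr; set d := q - r.
have qs := csq_star qq; have rs := csq_star rq.
have ds : star d = d by rewrite starB qs rs.
have dqr : (q + r) * d = 0.
  by rewrite mulrBr 2!mulrDl qqr qr [r * q + _]addrC subrr.
have qd : q * d = d * q by rewrite mulrBl mulrBr qr.
have rd : r * d = d * r by rewrite mulrBl mulrBr qr.
have s0 : d * q * d + d * r * d = 0.
  by rewrite -mulrDl -mulrDr -mulrA dqr mulr0.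
have q0 := csq_addr_eq0 (csqM2 qq ds qd) (csqM2 rq ds rd) s0.
have r0 : d * r * d = 0 by move: s0; rewrite q0 add0r.
have d3 : d * d * d = 0.
  have -> : d * d * d = d * q * d - d * r * d by rewrite -mulrBl -mulrBr.
  by rewrite q0 r0 subrr.
have : d * d = 0.
  by apply: cnorm_sa_nilpotent; rewrite ?starM ?ds // mulrA d3 mul0r.
by move/(cnorm_sa_nilpotent ds)/eqP; rewrite subr_eq0 => /eqP.
Qed.

(** The limit [l] of the series has norm at most 1, which is the criterion of [norm_csq] for
    [1 - l]. *)
Lemma sroot_csq t a h : 0 < t -> sroot t a h -> star a = a ->
  cnorm (t *:: 1 - a) <= t -> csq h.
Proof.
move=> t0 hr sa ta; have hs := sroot_star sa hr.
case: hr => l yl hE; rewrite hE; apply: csqZ; first exact: sqrtr_ge0.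
have q0 : cnorm (1 - t^-1 *:: a) <= 1.
  have -> : 1 - t^-1 *:: a = t^-1 *:: (t *:: 1 - a).
    by rewrite scalerBr scalerA -rmorphM /= mulVf ?gt_eqF // scale1r.
  by rewrite cnormZr gtr0_norm ?invr_gt0 // mulrC ler_pdivrMr // mul1r.
apply: (@norm_csq 1) => //.
  rewrite starB star1; congr (_ - _); apply: (clim_uniq _ yl);
    have := clim_star yl.
  congr (clim _ _); apply: funext => n; apply: yseq_star.
  by rewrite starB starZr star1 sa.
rewrite scale1r opprB addrC subrK; apply: clim_norm_le yl => n.
apply: le_trans (yseq_bound n (lexx _) q0) _.
have q01 : 0 <= cnorm (1 - t^-1 *:: a) <= 1 by rewrite cnorm_ge0 q0.
by have /andP[] := tseq_bound n q01.
Qed.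

Lemma sroot_csq_sqr t q h : 0 < t -> csq q -> cnorm (q * q) <= t ->
  sroot t (q * q) h -> h = q.
Proof.
move=> t0 qq qt hr; have qs := csq_star qq.
have q2 : csq (q * q) by exists q.
have hq := sroot_csq t0 hr (csq_star q2) (csq_norm t0 q2 qt).
apply: csq_sqrt_uniq => //; last exact: sroot_sqr hr.
by apply: (sroot_comm hr hr); rewrite mulrA.
Qed.

(* If [c* c = - p] with [p >= 0], then [s := c c* >= 0], and [s c = - c p]
   although [sqrt (s^2) c = c sqrt (p^2)]. *)
Lemma star_mul_nonpos c p : csq p -> star c * c = - p -> p = 0.
Proof.
move=> pq cp; pose s := c * star c.
pose h := c + star c; pose k := ('i%C : R[i]) *: (star c - c).
have i2 : ('i%C : R[i]) * 'i%C = -1 by rewrite -expr2 sqr_i.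
have hs : star h = h by rewrite starD starK addrC.
have ks : star k = k by rewrite starZi starB starK -scalerN opprB.
(* [h] and [k] are twice the real and imaginary parts of [c], so [h * h + k * k] is twice
   [c c* + c* c]. As [c* c = - p], this exhibits [s] as positive. *)
have hkE : 2%:R *: s = h * h + k * k + 2%:R *: p.
  have -> : h * h + k * k = 2%:R *: (s + star c * c).
    rewrite /k -scalerAl -scalerAr scalerA i2 scaleN1r /h.
    rewrite mulrBl !mulrBr !opprB mulrDl !mulrDr scaler_nat mulr2n /s.
    rewrite addrACA [_ + c * star c]addrC [X in X + _ = _]addrACA subrr addr0.
    by rewrite [X in _ + X = _]addrACA subrr addr0 addrACA.
  by rewrite cp -scalerDr subrK.
have sq : csq s.
  have -> : s = 2^-1 *:: (2%:R *: s).
    rewrite scalerA -(rmorph_nat (real_complex R)) -rmorphM /= mulVf //.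
    by rewrite scale1r.
  apply: csqZ; rewrite ?invr_ge0 // hkE; apply: csqD.
    by apply: csqD; [exists h|exists k].
  by rewrite -(rmorph_nat (real_complex R)); exact: csqZ.
have sc : s * c = - (c * p) by rewrite /s -mulrA cp mulrN.
have s2c : s * s * c = c * (p * p).
  by rewrite -(mulrA s s c) sc mulrN (mulrA s c p) sc mulNr opprK mulrA.
pose t := cnorm (s * s) + cnorm (p * p) + 1.
have := cnorm_ge0 (s * s); have := cnorm_ge0 (p * p) => n1 n2.
have t0 : 0 < t by rewrite /t; lra.
have ss : csq (s * s) by exists s => //; exact: csq_star.
have pp : csq (p * p) by exists p => //; exact: csq_star.
have ns : cnorm (s * s) <= t by rewrite /t; lra.
have np : cnorm (p * p) <= t by rewrite /t; lra.
have [hs' rs] := sroot_ex t0 (csq_norm t0 ss ns).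
have [hp rp] := sroot_ex t0 (csq_norm t0 pp np).
have := sroot_comm rs rp s2c.
rewrite (sroot_csq_sqr t0 sq ns rs) (sroot_csq_sqr t0 pq np rp) sc => /eqP.
rewrite -subr_eq0 -opprD oppr_eq0 -mulr2n -scaler_nat scaler_eq0 pnatr_eq0 /=.
move/eqP => cp0; apply: cnorm_sa_nilpotent; first exact: csq_star.
by rewrite -[X in X * _]opprK -cp mulNr -mulrA cp0 mulr0 oppr0.
Qed.

(* With [r := sqrt (a^2)] and [n := r - a], [(b n)* (b n) = n a n = - n r n]. *)
Lemma cpos_csq a : cpos a -> csq a.
Proof.
move=> [b aE]; have sa : star a = a by rewrite aE starM starK.
have a2 : csq (a * a) by exists a.
have a0 := cnorm_ge0 (a * a); pose t := cnorm (a * a) + 1.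
have t0 : 0 < t by rewrite /t; lra.
have at' := csq_norm t0 a2 (ltac:(rewrite /t; lra) : cnorm (a * a) <= t).
have [r rr] := sroot_ex t0 at'.
have rq := sroot_csq t0 rr (csq_star a2) at'.
have rE := sroot_sqr t0 rr; have rs := csq_star rq.
have ra : r * a = a * r by apply: (sroot_comm rr rr); rewrite mulrA.
pose n := r - a; have ns : star n = n by rewrite starB rs sa.
have na : n * (r + a) = 0.
  by rewrite mulrDr 2!mulrBl rE ra addrA subrK subrr.
have rn : r * n = n * r by rewrite mulrBl mulrBr ra.
have naE : n * a = - (n * r).
  by apply/eqP; rewrite -addr_eq0 -mulrDr addrC na.
have pq : csq (n * r * n) by exact: csqM2.
have := @star_mul_nonpos (b * n) _ pq.
rewrite starM ns mulrA -[n * _ * b]mulrA -aE naE mulNr => /(_ erefl) p0.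
have n2 : n * n = 2%:R *: (n * r).
  by rewrite {2}/n mulrBr naE opprK -mulr2n -scaler_nat.
have : n * n * n = 0 by rewrite n2 -scalerAl p0 scaler0.
move=> n3; have : n * n = 0.
  by apply: cnorm_sa_nilpotent; rewrite ?starM ?ns // mulrA n3 mul0r.
move/(cnorm_sa_nilpotent ns)/eqP; rewrite subr_eq0 => /eqP <-.
exact: rq.
Qed.

End CStarNorm.
(** * Operators on Hilbert modules *)

Section PreHilbert.
Variables (R : realType) (A : cstarType R).
Implicit Types (E F : innerModType A) (r c d : R).

(** Kept as a predicate so that it also covers the direct sum [P * Q], which carries only the
    structure of an inner product module. *)
Definition pre_hilbert E : Prop :=
  (forall x : E, csq (inner x x)) /\ (forall x : E, inner x x = 0 -> x = 0).

Lemma hilbert_pre (E : hilbertModType A) : pre_hilbert E.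
Proof.
by split=> [x|x /inner_def //]; apply: cpos_csq; exact: inner_pos.
Qed.

Lemma pre_hilbert_pair E F : pre_hilbert E -> pre_hilbert F ->
  pre_hilbert (E * F)%type.
Proof.
move=> [pE dE] [pF dF]; split=> [x|[x y]]; first exact: csqD.
rewrite [inner _ _]/(inner x x + inner y y) => xy0; congr (_, _).
  by apply: dE; exact: csq_addr_eq0 xy0.
by apply: dF; apply: csq_addr_eq0 (pF y) (pE x) _; rewrite addrC.
Qed.

Lemma hnorm_ge0 E (x : E) : 0 <= hnorm x.
Proof. exact: sqrtr_ge0. Qed.

Lemma hnorm_sqr E (x : E) : hnorm x ^+ 2 = cnorm (inner x x).
Proof. by rewrite sqr_sqrtr // cnorm_ge0. Qed.

Lemma hnorm0 E : hnorm (0 : E) = 0.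
Proof. by rewrite /hnorm inner0r cnorm0 sqrtr0. Qed.

Lemma hnormN E (x : E) : hnorm (- x) = hnorm x.
Proof. by rewrite /hnorm innerNl innerNr opprK. Qed.

Lemma hnorm_distC E (x y : E) : hnorm (x - y) = hnorm (y - x).
Proof. by rewrite -hnormN opprB. Qed.

Lemma hnorm_rscale E r (x : E) : hnorm (rscale r x) = `|r| * hnorm x.
Proof.
rewrite /hnorm /rscale innerZl innerZr star_real -scalerAl mul1r -scalerAr.
rewrite mulr1 !cnormZr mulrA -normrM sqrtrM ?normr_ge0 //; congr (_ * _).
by rewrite normrM -expr2 sqrtr_sqr normr_id.
Qed.

(** With [a = <x, y>], [z = x a - t y] and [t >= |<x, x>|], the element [t^2 <y, y>] is the sum of
    [t a* a] and the positive elements [<z, z>] and [a* (t - <x, x>) a]. Monotonicity of the norm on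
    positive elements gives [t |a|^2 <= t^2 |<y, y>|]. *)
Lemma cauchy_schwarz E (x y : E) : pre_hilbert E ->
  cnorm (inner x y) <= hnorm x * hnorm y.
Proof.
move=> [pE _]; set a := inner x y.
have key t : 0 < t -> cnorm (inner x x) <= t ->
    cnorm a ^+ 2 <= t * cnorm (inner y y).
  move=> t0 xt; pose z := (a : A^c) *: x - rscale t y.
  have [g gs gE] : csq (real_complex R t *: 1 - inner x x).
    apply: (@norm_csq _ _ t) => //.
      by rewrite starB innerC starZr star1.
    by rewrite opprB addrC subrK; exact: xt.
  have aga : csq (star a * (real_complex R t *: 1 - inner x x) * a).
    by apply: cpos_csq; exists (g * a); rewrite gE starM gs !mulrA.
  have aa : csq (real_complex R t *: (star a * a)).
    by apply: csqZ; [exact: ltW|apply: cpos_csq; exists a].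
  have zE : inner z z = star a * inner x x * a
      - 2%:R *: (real_complex R t *: (star a * a))
      + real_complex R t *: (real_complex R t *: inner y y).
    rewrite /z innerDr !innerDl !innerNl !innerNr opprK.
    rewrite /rscale !innerZl !innerZr !star_real -/a -(innerC x y) -/a.
    rewrite -!scalerAl !mul1r -!scalerAr !mulr1 mulrA.
    by rewrite scaler_nat mulr2n opprD !addrA.
  have e : real_complex R t *: (real_complex R t *: inner y y) =
      real_complex R t *: (star a * a) +
      (inner z z + star a * (real_complex R t *: 1 - inner x x) * a).
    rewrite zE mulrBr mulrBl -scalerAr -scalerAl mulr1 scaler_nat mulr2n.
    set p := star a * _ * a; set q := _ *: (star a * a).
    set w := _ *: (_ *: inner y y).
    rewrite [p - _ + w]addrC -addrA [q - p]addrC addrACA subrr add0r opprD.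
    by rewrite subrK [RHS]addrC subrK.
  have := csq_le_norm aa (csqD (pE z) aga); rewrite -e !cnormZr cnorm_star.
  by rewrite gtr0_norm // ler_pM2l.
have h0 := hnorm_ge0 x; have k0 := hnorm_ge0 y.
rewrite -ler_sqr ?nnegrE ?cnorm_ge0 ?mulr_ge0 // exprMn !hnorm_sqr.
apply/ler_addgt0Pr => e e0; have y0 := cnorm_ge0 (inner y y).
have x0 := cnorm_ge0 (inner x x).
(* [t] must be positive although [inner x x] may vanish; the margin [s] contributes at most [e]
   after multiplication by [cnorm (inner y y)]. *)
set s := e / (cnorm (inner y y) + 1).
have s0 : 0 < s by rewrite divr_gt0 //; lra.
have := key (cnorm (inner x x) + s) ltac:(lra) ltac:(lra).
have : s * (cnorm (inner y y) + 1) = e by rewrite divfK // gt_eqF //; lra.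
by move: (cnorm (inner y y)) (cnorm (inner x x)) (cnorm a) y0 => ? ? ? ?; nra.
Qed.

Lemma hnormD E (x y : E) : pre_hilbert E -> hnorm (x + y) <= hnorm x + hnorm y.
Proof.
move=> hE; have h0 := hnorm_ge0 x; have k0 := hnorm_ge0 y.
rewrite -ler_sqr ?nnegrE ?hnorm_ge0 ?addr_ge0 // hnorm_sqr innerDr !innerDl.
apply: le_trans (cnormD _ _) _; rewrite sqrrD !hnorm_sqr -addrA.
have := cauchy_schwarz x y hE; have := cauchy_schwarz y x hE.
have := cnormD (inner x x) (inner y x); have := cnormD (inner x y) (inner y y).
by rewrite mulr2n; lra.
Qed.

Lemma hnormD_sub E (x y z : E) : pre_hilbert E ->
  hnorm (x - z) <= hnorm (x - y) + hnorm (y - z).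
Proof. by move=> hE; apply: le_trans _ (hnormD _ _ hE);
  rewrite addrA subrK. Qed.

Lemma hnorm_sum E (J : finType) (f : J -> E) : pre_hilbert E ->
  hnorm (\sum_j f j) <= \sum_j hnorm (f j).
Proof.
move=> hE; elim/big_rec2: _ => [|j s x _ le]; first by rewrite hnorm0.
by apply: le_trans (hnormD _ _ hE) _; exact: lerD.
Qed.

Lemma inner_inj E (x y : E) : pre_hilbert E ->
  (forall z, inner x z = inner y z) -> x = y.
Proof.
move=> [_ dE] xy; apply/eqP; rewrite -subr_eq0; apply/eqP/dE.
by rewrite innerDl innerNl xy subrr.
Qed.

Section Linear.
Variables (E F : innerModType A).
Hypothesis hF : pre_hilbert F.
Implicit Types S T : adjop E F.

Lemma adjopD T x y : T (x + y) = T x + T y.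
Proof. by apply: inner_inj => // z; rewrite innerDl !opadjP innerDl. Qed.

Lemma adjopN T x : T (- x) = - T x.
Proof. by apply: inner_inj => // z; rewrite innerNl !opadjP innerNl. Qed.

Lemma adjopB T x y : T (x - y) = T x - T y.
Proof. by rewrite adjopD adjopN. Qed.

Lemma adjop_rscale T r x : T (rscale r x) = rscale r (T x).
Proof.
by apply: inner_inj => // z; rewrite inner_rscale !opadjP inner_rscale
   /rscale -!opadjP !innerZr opadjP.
Qed.

Lemma opnorm_ge0 T : (0 <= opnorm T)%E.
Proof.
apply: ereal_sup_ubound; exists 0 => /=; first by rewrite hnorm0 ler01.
suff -> : T 0 = 0 by rewrite hnorm0.
by rewrite -(subrr (0 : E)) adjopB subrr.
Qed.

Lemma opnorm_le T c : 0 <= c -> (forall x, hnorm (T x) <= c * hnorm x) ->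
  (opnorm T <= c%:E)%E.
Proof.
move=> c0 Tc; apply: ge_ereal_sup => _ [x /= x1 <-].
by rewrite lee_fin (le_trans (Tc x)) // ler_piMr.
Qed.

Lemma opnorm_bound T c x : (opnorm T <= c%:E)%E -> hnorm (T x) <= c * hnorm x.
Proof.
move=> Tc.
have b y : hnorm y <= 1 -> hnorm (T y) <= c.
  move=> y1; rewrite -lee_fin; apply: le_trans Tc; apply: ereal_sup_ubound.
  by exists y.
have c0 : 0 <= c by rewrite -lee_fin; exact: le_trans (opnorm_ge0 T) Tc.
apply/ler_addgt0Pr => e e0; have x0 := hnorm_ge0 x.
(* As [hnorm x] may vanish, [x] is divided by a slightly larger number; the margin costs at most [e]
   after multiplication by [c]. *)
set s := hnorm x + e / (c + 1).
have u0 : 0 < e / (c + 1) by rewrite divr_gt0 //; lra.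
have s0 : 0 < s by rewrite /s; lra.
have := b (rscale s^-1 x); rewrite adjop_rscale !hnorm_rscale.
rewrite gtr0_norm ?invr_gt0 // ![s^-1 * _]mulrC !ler_pdivrMr // mul1r.
have : e / (c + 1) * (c + 1) = e by rewrite divfK // gt_eqF //; lra.
by rewrite /s; move: (e / (c + 1)) u0 => u u0 uE /(_ ltac:(lra)); nra.
Qed.

(** The pointwise form of a bound by [c] on the norm of [S - T]; it keeps the estimates in [R],
    whereas [opnorm] may be infinite. *)
Definition op_near c S T : Prop := forall x, hnorm (S x - T x) <= c * hnorm x.

Lemma near_opnorm c S T : 0 <= c -> op_near c S T -> (opnorm (S - T) <= c%:E)%E.
Proof. by move=> c0 ST; exact: opnorm_le. Qed.

Lemma opnorm_near c S T : (opnorm (S - T) < c%:E)%E -> op_near c S T.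
Proof. by move=> /ltW ST x; exact: opnorm_bound ST. Qed.

Lemma near_refl c T : 0 <= c -> op_near c T T.
Proof. by move=> c0 x; rewrite subrr hnorm0 mulr_ge0 // hnorm_ge0. Qed.

Lemma near_sym c S T : op_near c S T -> op_near c T S.
Proof. by move=> ST x; rewrite hnorm_distC. Qed.

Lemma near_trans c d S T U : op_near c S T -> op_near d T U ->
  op_near (c + d) S U.
Proof.
move=> ST TU x; apply: le_trans (hnormD_sub _ (T x) _ hF) _.
by rewrite mulrDl lerD.
Qed.

Lemma near_le c d S T : c <= d -> op_near c S T -> op_near d S T.
Proof.
by move=> cd ST x; apply: le_trans (ST x) _; rewrite ler_wpM2r ?hnorm_ge0.
Qed.

Lemma opnorm_near_le c d S S' T T' : 0 <= c -> 0 <= d -> op_near c S T ->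
  op_near d S' T' ->
  (opnorm (S - S') <= opnorm (T - T') + (c + d)%:E)%E.
Proof.
move=> c0 d0 ST ST'; apply: ge_ereal_sup => _ [x /= x1 <-].
have : ((hnorm (T x - T' x))%:E <= opnorm (T - T'))%E.
  by apply: ereal_sup_ubound; exists x.
move=> /(leeD2r (c + d)%:E); apply: le_trans.
rewrite -EFinD lee_fin.
have := ST x; have := ST' x; have := hnormD_sub (S x) (T x) (S' x) hF.
have := hnormD_sub (T x) (T' x) (S' x) hF; rewrite (hnorm_distC (T' x)).
have : c * hnorm x <= c by rewrite ler_piMr.
have : d * hnorm x <= d by rewrite ler_piMr.
by lra.
Qed.

End Linear.

Definition op_contraction E F (T : adjop E F) : Prop :=
  forall x, hnorm (T x) <= hnorm x.

(** From [S T - S' T' = S (T - T') + (S - S') T'], so only one factor on each side has to be a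
    contraction. *)
Lemma near_comp E F G (S S' : adjop F G) (T T' : adjop E F) c d :
  pre_hilbert G -> op_contraction S -> op_contraction T' -> 0 <= d ->
  op_near d S S' -> op_near c T T' -> op_near (c + d) (S ** T) (S' ** T').
Proof.
move=> hG cS cT' d0 SS TT x /=.
apply: le_trans (hnormD_sub _ (S (T' x)) _ hG) _.
rewrite -adjopB // mulrDl; apply: lerD; first exact: le_trans (cS _) (TT x).
by apply: le_trans (SS _) _; rewrite ler_wpM2l.
Qed.

Lemma op_contraction1 E : op_contraction (op1 E).
Proof. by []. Qed.

Lemma op_contraction_comp E F G (S : adjop F G) (T : adjop E F) :
  op_contraction S -> op_contraction T -> op_contraction (S ** T).
Proof. by move=> cS cT x; exact: le_trans (cS _) (cT _). Qed.

(** [|T* x|^2 = |<T T* x, x>| <= |T* x| |x|]; the next lemma runs the same argument for a difference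
    of operators. *)
Lemma op_contraction_adj E F (T : adjop E F) : pre_hilbert E ->
  pre_hilbert F -> op_contraction T -> op_contraction T^adj.
Proof.
move=> hE hF cT x; have := cauchy_schwarz (T (T^adj x)) x hF.
rewrite opadjP -hnorm_sqr; have := cT (T^adj x).
rewrite /=; have := hnorm_ge0 x; have := hnorm_ge0 (opadj T x).
move: (hnorm _) (hnorm x) (hnorm _) => p q s; rewrite le_eqVlt.
by move=> /orP[/eqP <-//|p0] q0 sp h; rewrite -(ler_pM2l p0) -expr2; nra.
Qed.

Lemma near_adj E F (S T : adjop E F) c : pre_hilbert E -> pre_hilbert F ->
  0 <= c -> op_near c S T -> op_near c S^adj T^adj.
Proof.
move=> hE hF c0 ST x /=; have := cauchy_schwarz ((S - T) ((S - T)^adj x)) x hF.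
rewrite opadjP -hnorm_sqr; have := ST ((S - T)^adj x).
rewrite /=; set y := opadj S x - opadj T x.
have := hnorm_ge0 x; have := hnorm_ge0 y; rewrite le_eqVlt.
move: (hnorm y) (hnorm x) (hnorm _) => p q s.
move=> /orP[/eqP <- q0 _ _|p0 q0 sp h]; first by rewrite mulr_ge0.
by rewrite -(ler_pM2l p0) -expr2; nra.
Qed.

Lemma opadjB E F (T : adjop E F) x y : pre_hilbert E ->
  opadj T (x - y) = opadj T x - opadj T y.
Proof. by move=> hE; exact: (adjopB hE T^adj). Qed.

Lemma opadj_rscale E F (T : adjop E F) r x : pre_hilbert E ->
  opadj T (rscale r x) = rscale r (opadj T x).
Proof. by move=> hE; exact: (adjop_rscale hE T^adj). Qed.

Section Unitary.
Variable E : innerModType A.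
Implicit Types u v : adjop E E.

Lemma unitary_adjK u x : unitary u -> opadj u (u x) = x.
Proof. by move=> [/(congr1 (fun T : adjop E E => T x))]. Qed.

Lemma unitary_Kadj u x : unitary u -> u (opadj u x) = x.
Proof. by move=> [_ /(congr1 (fun T : adjop E E => T x))]. Qed.

Lemma unitary_adj u : unitary u -> unitary u^adj.
Proof.
by move=> [u1 u2]; split; [rewrite -[RHS]u2|rewrite -[RHS]u1]; apply: adjop_eq.
Qed.

Lemma unitary1 : unitary (op1 E).
Proof. by split; exact: adjop_eq. Qed.

Lemma unitary_comp u v : unitary u -> unitary v -> unitary (u ** v).
Proof.
move=> hu hv; split; apply: adjop_eq => x /=.
  by rewrite (unitary_adjK _ hu) (unitary_adjK _ hv).
  by rewrite (unitary_adjK _ hu) (unitary_adjK _ hv).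
  by rewrite (unitary_Kadj _ hv) (unitary_Kadj _ hu).
  by rewrite (unitary_Kadj _ hv) (unitary_Kadj _ hu).
Qed.

Lemma unitary_contraction u : unitary u -> op_contraction u.
Proof.
by move=> hu x; rewrite /hnorm opadjP unitary_adjK.
Qed.

(** Meant for the diagonal values [v m m] of a cocycle, which the cocycle identity makes
    idempotent. *)
Lemma unitary_idem u : unitary u -> u ** u = u -> forall x, u x = x.
Proof.
move=> hu uu x; have uux : u (u x) = u x by rewrite -[in RHS]uu.
by rewrite -[LHS](unitary_adjK _ hu) uux unitary_adjK.
Qed.

(* If [S = B* B] squares to [1], then [y := S x - x] satisfies [S y = - y],
   so [<y, y> + <B y, B y> = 0]. *)
Lemma inv_sqrt1 x : pre_hilbert E -> inv_sqrt (op1 E) x = x.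
Proof.
move=> hE; rewrite /inv_sqrt.
case: xgetP => [S _ [[B SE] S1 _]|/(_ (op1 E))]; last first.
  case; split; first by exists (op1 E); exact: adjop_eq.
    exact: adjop_eq.
  exact: adjop_eq.
have {}S1 : S (S x) = x by move/(congr1 (fun T : adjop E E => T x)): S1.
pose y := S x - x; suff /eqP : y = 0 by rewrite subr_eq0 => /eqP.
have Sy : S y = - y by rewrite adjopB // S1 opprB.
apply: hE.2; apply: (csq_addr_eq0 (hE.1 y) (hE.1 (B y))).
have -> : inner (B y) (B y) = inner y (S y) by rewrite opadjP SE.
by rewrite Sy innerNr subrr.
Qed.

End Unitary.

Section Opsum.
Variables (E F : innerModType A).
Hypotheses (hE : pre_hilbert E) (hF : pre_hilbert F).

Lemma hnorm_pair_fst (x : E * F) : hnorm x.1 <= hnorm x.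
Proof.
rewrite /hnorm ler_wsqrtr //.
exact: (csq_le_norm (hE.1 x.1) (hF.1 x.2)).
Qed.

Lemma hnorm_pair_snd (x : E * F) : hnorm x.2 <= hnorm x.
Proof.
rewrite /hnorm ler_wsqrtr //; have := csq_le_norm (hF.1 x.2) (hE.1 x.1).
by rewrite addrC.
Qed.

Lemma hnorm_pair_le (x : E * F) : hnorm x <= hnorm x.1 + hnorm x.2.
Proof.
have h1 := hnorm_ge0 x.1; have h2 := hnorm_ge0 x.2.
rewrite -ler_sqr ?nnegrE ?hnorm_ge0 ?addr_ge0 // hnorm_sqr.
apply: le_trans (cnormD _ _) _; rewrite -!hnorm_sqr.
by nra.
Qed.

Lemma near_opsum c d (S S' : adjop E E) (T T' : adjop F F) : 0 <= c -> 0 <= d ->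
  op_near c S S' -> op_near d T T' -> op_near (c + d) (opsum S T) (opsum S' T').
Proof.
move=> c0 d0 SS TT x; apply: le_trans (hnorm_pair_le _) _ => /=.
rewrite mulrDl; apply: lerD.
  by apply: le_trans (SS _) _; rewrite ler_wpM2l // hnorm_pair_fst.
by apply: le_trans (TT _) _; rewrite ler_wpM2l // hnorm_pair_snd.
Qed.

Lemma opsum1 : opsum (op1 E) (op1 F) = op1 (E * F)%type.
Proof. by apply: adjop_eq => -[]. Qed.
End Opsum.

End PreHilbert.
(** * Trees, nerves and edge paths *)

Section Graphs.
Variable I : finType.
Implicit Types (N G : {set {set I}}) (S : {set I}) (a b c k m n x y : I) (p q
  s t w : seq I).

Lemma adjacent_sym G : symmetric (adjacent G).
Proof. by move=> a b; rewrite /adjacent eq_sym finset.setUC. Qed.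

Lemma complex_sub N S (S' : {set I}) : simplicial_complex N -> S \in N ->
  S' \subset S ->
  S' != finset.set0 -> S' \in N.
Proof. by move=> [_ h]; exact: h. Qed.

Lemma complex_pairl N a b : simplicial_complex N -> [set a; b]%SET \in N ->
  [set a]%SET \in N.
Proof.
move=> hN /(complex_sub hN); apply; first by rewrite finset.sub1set !inE eqxx.
by apply/set0Pn; exists a; rewrite inE.
Qed.

Lemma complex_pairr N a b : simplicial_complex N -> [set a; b]%SET \in N ->
  [set b]%SET \in N.
Proof. by rewrite finset.setUC; exact: complex_pairl. Qed.

Lemma subset_pair (S : {set I}) a b : S \subset [set a; b]%SET ->
  S != finset.set0 -> [\/ S = [set a]%SET, S = [set b]%SET | S = [set a;
    b]%SET].
Proof.
move=> /fintype.subsetP Sab /set0Pn[z zS].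
have [aS|aS] := boolP (a \in S); have [bS|bS] := boolP (b \in S).
- apply: Or33; apply/finset.setP => y; rewrite !inE; apply/idP/orP.
    by move/Sab; rewrite !inE => /orP.
  by case=> /eqP ->.
- apply: Or31; apply/finset.setP => y; rewrite !inE;
  apply/idP/eqP => [yS|-> //].
  move/Sab: (yS); rewrite !inE => /orP[/eqP //|/eqP yb].
  by rewrite yb (negbTE bS) in yS.
- apply: Or32; apply/finset.setP => y; rewrite !inE;
  apply/idP/eqP => [yS|-> //].
  move/Sab: (yS); rewrite !inE => /orP[/eqP yb|/eqP //].
  by rewrite yb (negbTE aS) in yS.
- by move/Sab: (zS); rewrite !inE => /orP[] /eqP zE;
    rewrite zE ?(negbTE aS) ?(negbTE bS) in zS.
Qed.

Lemma connect_boundary (e : rel I) (V : pred I) a b : connect e a b ->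
  V a -> ~~ V b -> exists x y, [/\ e x y, V x & ~~ V y].
Proof.
move=> /connectP[p]; elim: p a => [|c p IH] a /=; first by move=> _ -> ->.
move=> /andP[ac cp] bE Va Vb; have [Vc|Vc] := boolP (V c);
  first exact: (IH c cp bE Vc Vb).
by exists a, c.
Qed.

Lemma tree_add_leaf G x y : is_tree G -> [set x]%SET \in G ->
  [set y]%SET \notin G ->
  is_tree (G :|: [set [set y]; [set x; y]]%SET)%SET.
Proof.
move=> [cG G0 Gle Gc Gcyc] xG yG; set G' := (_ :|: _)%SET.
have xy : x != y by apply: contraNneq yG => <-.
have GG' S : S \in G -> S \in G' by move=> SG; rewrite !inE SG.
have yG' : [set y]%SET \in G' by rewrite !inE eqxx orbT.
have xyG' : [set x; y]%SET \in G' by rewrite !inE eqxx !orbT.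
have G'P S : S \in G' -> [\/ S \in G, S = [set y]%SET | S = [set x; y]%SET].
  by rewrite !inE => /or3P[|/eqP|/eqP]; [apply: Or31|apply: Or32|apply: Or33].
have GxG' a b : adjacent G a b -> adjacent G' a b.
  by move=> /andP[ab abG]; rewrite /adjacent ab GG'.
have yadj b : adjacent G' y b -> b = x.
  move=> /andP[yb] /G'P[ybG|/finset.setP/(_ b)|/finset.setP/(_ b)].
  - by rewrite (complex_pairl cG ybG) in yG.
  - by rewrite !inE eqxx orbT => /esym/eqP yb'; rewrite yb' eqxx in yb.
  - rewrite !inE eqxx orbT => /esym/orP[/eqP //|/eqP yb'].
    by rewrite yb' eqxx in yb.
split.
- split=> [|S S' /G'P[SG S'S S'0|-> |->]].
  + apply/negP => /G'P[|/finset.setP/(_ y)|/finset.setP/(_ y)].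
    * by apply/negP; exact: cG.1.
    * by rewrite !inE eqxx.
    * by rewrite !inE eqxx orbT.
  + by apply: GG'; exact: complex_sub S'S S'0.
  + by rewrite finset.subset1 => /orP[/eqP ->|/eqP ->]; rewrite ?eqxx.
  + by move=> /subset_pair h /h[] -> //; exact: GG'.
- by apply/set0Pn; exists [set y]%SET.
- by move=> S /G'P[/Gle //|->|->]; rewrite ?cards1 // cards2; case: (x != y).
- have c1 a : [set a]%SET \in G' -> connect (adjacent G') x a.
    move=> /G'P[aG|/finset.set1_inj ->|/finset.setP h].
    + by apply: connect_sub (Gc _ _ xG aG) => u v /GxG' /connect1.
    + by apply: connect1; rewrite /adjacent xy.
    + have := h x; have := h y; rewrite !inE !eqxx orbT /=.
      by move=> /eqP ya /eqP xa; rewrite xa ya eqxx in xy.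
  move=> a b aG' bG'; apply: connect_trans (c1 b bG').
  by rewrite (sym_connect_sym (adjacent_sym _)) c1.
- move=> c cc; have [yc|yc] := boolP (y \in c); last first.
    apply: Gcyc; move: cc; rewrite /ucycle => /andP[cc ->]; rewrite andbT.
    apply: (@sub_in_cycle _ (predC1 y)) cc => [a b /= ay b_y|]; last first.
      by apply/allP => z zc; apply: contraNneq yc => <-.
    move=> /andP[ab /G'P[abG||]]; first by rewrite /adjacent ab.
      by move/finset.setP/(_ a); rewrite !inE eqxx => /esym/eqP /= aE;
        rewrite aE inE eqxx in ay.
    move/finset.setP/(_ y); rewrite !inE eqxx orbT => /orP[] /eqP yE.
      by rewrite yE inE eqxx in ay.
    by rewrite yE inE eqxx in b_y.
  (* Rotated to start at [y], whose only neighbour is [x], the cycle has [x] both second and last;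
     with three or more vertices it would repeat [x]. *)
  have [i c' rE] := rot_to yc.
  rewrite -(size_rot i) rE; move: cc; rewrite -(rot_ucycle i) rE => /andP[].
  case: c' {rE} => [//|b [//|d c']] /=.
  move=> /andP[/yadj -> /andP[_]]; rewrite rcons_path => /andP[_].
  rewrite adjacent_sym => /yadj lx /andP[_ /andP[]].
  by rewrite -lx mem_last.
Qed.

(** If a vertex were missed, connectedness would give an edge leaving the tree, and adding it as a
    leaf would contradict maximality. *)
Lemma maximal_subtree_spanning N G : simplicial_complex N ->
  (forall a b, [set a]%SET \in N -> [set b]%SET \in N ->
     connect (adjacent N) a b) ->
  maximal_subtree (skel1 N) G -> forall m, [set m]%SET \in N ->
  [set m]%SET \in G.
Proof.
move=> cN Nc [tG GN Gmax] m mN; apply/negPn/negP => mG.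
have [cG /set0Pn[S SG] _ _ _] := tG.
have [a aS] : exists a, a \in S.
  by apply/set0Pn; apply: contraNneq cG.1 => <-.
have aG : [set a]%SET \in G.
  apply: complex_sub SG _ _ => //; first by rewrite finset.sub1set.
  by apply/set0Pn; exists a; rewrite inE.
have skN S' : S' \in G -> S' \in N.
  by move/(fintype.subsetP GN); rewrite inE => /andP[].
have [x [y [/andP[xy xyN] xG yG]]] :=
  connect_boundary (V := fun z => [set z]%SET \in G) (Nc _ _ (skN _ aG) mN) aG
    mG.
have tG' := tree_add_leaf tG xG yG.
have := Gmax _ tG' _ (finset.subsetUl _ _).
move=> GE; move: yG; rewrite -[G]GE ?inE ?eqxx ?orbT //.
rewrite finset.subUset GN; apply/fintype.subsetP => S'.
rewrite !inE => /orP[] /eqP ->.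
  by rewrite (complex_pairr cN xyN) cards1.
by rewrite xyN cards2 xy.
Qed.

Lemma tree_pathP G m0 m : is_tree G -> [set m0]%SET \in G ->
  [set m]%SET \in G -> minimal_path G m0 m (tree_path G m0 m).
Proof.
move=> [_ _ _ Gc _] m0G mG; rewrite /tree_path.
apply: xgetPex; have /connectP[p0 p0p p0m] := Gc _ _ m0G mG.
pose P j := `[< exists2 p, path (adjacent G) m0 p /\ last m0 p = m & size p =
  j >].
have exP : exists j, P j by exists (size p0); apply/asboolP; exists p0.
case: (ex_minnP exP) => j /asboolP[p [pp pm] <-] pmin.
by exists p; split=> // q qp qm; apply: pmin; apply/asboolP; exists q.
Qed.

Lemma tree_path_size G m0 m p : minimal_path G m0 m p -> (size p < #|I|)%N.
Proof.
move=> [pp pm pmin]; move: pm; case: (shortenP pp) => q qp qu _ lq.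
apply: leq_ltn_trans (pmin q qp lq) _.
by have := max_card (mem (m0 :: q)); rewrite (card_uniqP qu).
Qed.

(* Cut at the first repeated vertex, a closed walk is a simple cycle; in a tree
   it has length two. *)
Lemma backtrack G w : is_tree G -> sorted (adjacent G) w -> ~~ uniq w ->
  exists s t a b, w = s ++ [:: a, b, a & t].
Proof.
move=> tG; elim: w => [//|x w IH] xw.
have [uw|uw _] := boolP (uniq w); last first.
  have [s [t [a [b ->]]]] := IH (path_sorted xw) uw.
  by exists (x :: s), t, a, b.
rewrite /= uw andbT negbK => xinw.
move: xw uw; case/splitPr: xinw => s1 s2 /=.
rewrite cat_path /= cat_uniq /= negb_or => /and3P[p1 lx _] /and3P[u1 /andP[xs1
  _] _].
have cyc : ucycle (adjacent G) (x :: s1).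
  by rewrite /ucycle /= rcons_path p1 lx xs1 u1.
have [_ _ _ _ /(_ _ cyc)] := tG.
case: s1 lx {p1 u1 xs1 cyc} => [|b [|//]] /=; first by rewrite /adjacent eqxx.
by move=> _ _; exists [::], s2, x, b.
Qed.

(** * Homotopies of edge paths and relations between the classes [gamma] *)

Section Homotopy.
Local Open Scope quotient_scope.
Variable N : {set {set I}}.
Hypothesis cN : simplicial_complex N.

(* Elementary homotopies of words that need not be loops, so that they can be
   applied inside a context. *)
Definition hmove w w' : Prop :=
  (exists s t a, w = s ++ [:: a, a & t] /\ w' = s ++ a :: t) \/
  (exists s t a b c, [/\ ([set a; b; c] \in N)%SET, w = s ++ [:: a, b, c & t]
     & w' = s ++ [:: a, c & t]]).

Definition hsim := clos_refl_sym_trans (seq I) hmove.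

Lemma hsim_ctx s t w w' : hsim w w' -> hsim (s ++ w ++ t) (s ++ w' ++ t).
Proof.
elim=> [{}w {}w' h|*|*|{}w {}w' w'' _ h _ h'];
  [|exact: rst_refl|exact: rst_sym|exact: rst_trans h h'].
apply: rst_step; case: h => [[s' [t' [a [-> ->]]]]|].
  by left; exists (s ++ s'), (t' ++ t), a; rewrite -!catA.
move=> [s' [t' [a [b [c [abc -> ->]]]]]].
by right; exists (s ++ s'), (t' ++ t), a, b, c; rewrite -!catA.
Qed.

Lemma hsim_dup s t a : hsim (s ++ [:: a, a & t]) (s ++ a :: t).
Proof. by apply: rst_step; left; exists s, t, a. Qed.

Lemma hsim_tri s t a b c : ([set a; b; c] \in N)%SET ->
  hsim (s ++ [:: a, b, c & t]) (s ++ [:: a, c & t]).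
Proof. by move=> abc; apply: rst_step; right; exists s, t, a, b, c. Qed.

Lemma hsim_aba s t a b : edge N a b ->
  hsim (s ++ [:: a, b, a & t]) (s ++ a :: t).
Proof.
rewrite /edge => /orP[/eqP <-|/= abN].
  exact: rst_trans (hsim_dup _ _ _) (hsim_dup _ _ _).
apply: rst_trans (hsim_dup _ _ _); apply: hsim_tri.
by rewrite finset.setUC finset.setUA finset.setUid.
Qed.

Lemma hsim_back x p : path (edge N) x p ->
  hsim (x :: p ++ rev (belast x p)) [:: x].
Proof.
elim: p x => [|y p IH] x /=; first by move=> _; exact: rst_refl.
move=> /andP[xy /IH h]; rewrite rev_cons -cats1 catA.
apply: rst_trans (hsim_ctx [:: x] [:: x] h) _.
exact: (hsim_aba [::] [::]).
Qed.

Lemma belast_rev x p : belast (last x p) (rev (belast x p)) = rev p.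
Proof.
apply: (@rcons_injl _ x).
have -> : rcons (rev p) x = rev (x :: p) by rewrite rev_cons.
rewrite lastI rev_rcons [RHS]lastI; congr (rcons _ _).
by rewrite last_back; case: p.
Qed.

Lemma hsim_forth x p : path (edge N) x p ->
  hsim (last x p :: rev (belast x p) ++ p) [:: last x p].
Proof.
move=> /(path_back (N := N)) /hsim_back; by rewrite belast_rev revK.
Qed.

Lemma edge_triangle a b c : ([set a; b; c] \in N)%SET ->
  [/\ edge N a b, edge N b c & edge N a c].
Proof.
have sub x y : [set x; y]%SET \subset [set a; b; c]%SET ->
    ([set a; b; c] \in N)%SET -> edge N x y.
  move=> xyS /(complex_sub cN)/(_ xyS) h; apply/orP; right.
  by apply: h; apply/set0Pn; exists x; rewrite !inE eqxx.
move=> abc; split; apply: sub abc; apply/fintype.subsetP => z;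
  by rewrite !inE => /orP[] ->; rewrite ?orbT.
Qed.

Variable m0 : I.

Definition loop_word w : bool :=
  [&& sorted (edge N) w, ohead w == Some m0 & last m0 w == m0].

Lemma loop_wordP w : loop_word w -> exists p : loop N m0, m0 :: val p = w.
Proof.
case: w => [|x p] /and3P[] //= px /eqP[xE] lx; rewrite xE in px lx *.
have h : is_loop N m0 p by apply/andP; split.
by exists (Sub p h).
Qed.

Lemma word_loop (p : loop N m0) : loop_word (m0 :: val p).
Proof. by case: p => p /= /andP[pp lp]; rewrite /loop_word /= pp eqxx. Qed.

Lemma hmove_loop w w' : hmove w w' -> loop_word w = loop_word w'.
Proof.
case=> [[s [t [a [-> ->]]]]|[s [t [a [b [c [/edge_triangle[ab bc ac] ->
  ->]]]]]]].
  rewrite /loop_word !last_cat /=; case: s => [|x s] /=; rewrite /edge ?eqxx //.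
  by rewrite !cat_path /= /edge eqxx.
rewrite /loop_word !last_cat /=; case: s => [|x s] /=; rewrite ?ab ?bc ?ac //.
by rewrite !cat_path /= ab bc ac.
Qed.

(** Each move preserves [loop_word] in both directions, so a chain of moves that joins two loops
    consists of loops. The equality is carried through the induction because transitivity needs the
    intermediate word to be a loop. *)
Lemma hsim_homotopic_ex w w' : hsim w w' -> loop_word w = loop_word w' /\
  forall p p' : loop N m0, m0 :: val p = w -> m0 :: val p' = w' ->
    homotopic p p'.
Proof.
elim=> [{}w {}w' h|{}w|{}w {}w' _ [e h]|{}w {}w' w'' _ [e h] _ [e' h']].
- split; first exact: hmove_loop.
  move=> p p' pE pE'; apply: rst_step.
  by rewrite /elem_homotopy pE pE'; case: h; [left|right].
- split=> // p p' <- [] /val_inj ->; exact: rst_refl.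
- by split=> // p p' pE pE'; apply: rst_sym; exact: h.
- split; first by rewrite e.
  move=> p p' pE pE'; have : loop_word w' by rewrite -e -pE word_loop.
  by case/loop_wordP => q qE; apply: rst_trans (h _ _ pE qE) (h' _ _ qE pE').
Qed.

Lemma hsim_homotopic (p q : loop N m0) :
  hsim (m0 :: val p) (m0 :: val q) -> homotopic p q.
Proof. by move/hsim_homotopic_ex => [_]; exact. Qed.

Variable G : {set {set I}}.
Hypotheses (tG : is_tree G) (GN : G \subset skel1 N) (m0G : [set m0]%SET \in G).

Lemma tree_edge a b : adjacent G a b -> edge N a b.
Proof.
move=> /andP[_ /(fintype.subsetP GN)]; rewrite inE => /andP[abN _].
by rewrite /edge /= abN orbT.
Qed.

(** A nonconstant closed walk repeats its base vertex, so [backtrack] finds [a, b, a] in it;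
    contracting this to [a] shortens the walk. *)
Lemma tree_loop_null x p : path (adjacent G) x p -> last x p = x ->
  hsim (x :: p) [:: x].
Proof.
have [j] := ubnP (size p); elim: j p => // j IH p pj pp lp.
have [|up] := boolP (uniq (x :: p)).
  case: p pp lp {pj} => [|y p] _ lp; first by move=> _; exact: rst_refl.
  by rewrite /= -{1}lp /= mem_last.
have [s [t [a [b pE]]]] := backtrack tG (pp : sorted _ (x :: p)) up.
rewrite pE; have ab : adjacent G a b.
  move: (pp : sorted _ (x :: p)); rewrite pE; case: (s) => [|z s'] /=.
    by case/andP.
  by rewrite cat_path /= => /and3P[_ _ /andP[]].
apply: rst_trans (hsim_aba s t (tree_edge ab)) _.
(* The backtrack may start at the base vertex itself, in which case no prefix remains before it. *)
case: s pE => [|z s] [xE pE]; rewrite -xE.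
  rewrite -xE in pE; rewrite pE /= in pj pp lp *; apply: IH => //.
    by move: pj; rewrite ltnS => /ltnW.
  by move: pp => /and3P[].
rewrite cat_cons; apply: IH.
- by move: pj; rewrite pE !size_cat /= !addnS; exact: ltnW.
- by move: pp; rewrite pE !cat_path /= => /and5P[-> -> _ _ ->].
- by rewrite -{2}lp pE !last_cat.
Qed.

Lemma tree_pathS m : [set m]%SET \in G ->
  path (adjacent G) m0 (tree_path G m0 m) /\ last m0 (tree_path G m0 m) = m.
Proof. by move=> mG; have [] := tree_pathP tG m0G mG. Qed.

Definition gamma_word m n : seq I :=
  tree_path G m0 n ++ m :: rev (belast m0 (tree_path G m0 m)).

Lemma gamma_word_loop m n : [set m]%SET \in G -> [set n]%SET \in G ->
  edge N n m -> is_loop N m0 (gamma_word m n).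
Proof.
move=> /tree_pathS[pm lm] /tree_pathS[pn ln] nm.
have pm' := sub_path tree_edge pm; have pn' := sub_path tree_edge pn.
rewrite /is_loop /gamma_word cat_path last_cat /= ln nm pn' /=.
rewrite -{1}lm path_back //= last_back.
by case: (tree_path G m0 m) lm => [/= ->|]; rewrite eqxx.
Qed.

Lemma gammaE m n (h : is_loop N m0 (gamma_word m n)) :
  gamma N G m0 m n = \pi_(pi1 N m0) (Sub (gamma_word m n) h).
Proof.
by rewrite /gamma; congr (\pi_(pi1 N m0) _); apply: val_inj; rewrite insubdK.
Qed.

Lemma pi1_eq_hsim p q (hp : is_loop N m0 p) (hq : is_loop N m0 q) :
  hsim (m0 :: p) (m0 :: q) ->
  \pi_(pi1 N m0) (Sub p hp : loop N m0) = \pi_(pi1 N m0) (Sub q hq : loop N m0).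
Proof. by move=> pq; apply/eqP/pi1_eqP; exact: hsim_homotopic. Qed.

Lemma gamma_diag m : [set m]%SET \in G -> gamma N G m0 m m = 1%g.
Proof.
move=> mG; have mm : edge N m m by rewrite /edge eqxx.
rewrite (gammaE (gamma_word_loop mG mG mm)).
apply: pi1_eq_hsim; have [pm lm] := tree_pathS mG.
apply: rst_trans (hsim_back (sub_path tree_edge pm)).
rewrite /gamma_word -!cat_cons !(lastI m0 (tree_path _ _ _)) lm !cat_rcons.
exact: hsim_dup.
Qed.

Lemma gamma_tree m n : adjacent G m n -> gamma N G m0 m n = 1%g.
Proof.
move=> mn; have [cG _ _ _ _] := tG.
have mG : [set m]%SET \in G by case/andP: mn => _; exact: complex_pairl.
have nG : [set n]%SET \in G by case/andP: mn => _; exact: complex_pairr.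
have nm : edge N n m by apply: tree_edge; rewrite adjacent_sym.
rewrite (gammaE (gamma_word_loop mG nG nm)); apply: pi1_eq_hsim.
have [pm lm] := tree_pathS mG; have [pn ln] := tree_pathS nG.
apply: tree_loop_null; rewrite /gamma_word ?cat_path ?last_cat /=.
  rewrite pn ln adjacent_sym mn -{1}lm rev_path (eq_path (e' := adjacent G)) //.
  by move=> a b; exact: adjacent_sym.
by rewrite last_back; case: (tree_path G m0 m) lm.
Qed.

(** In the concatenated word the way back from [m] cancels against the way out to [m], and the
    triangle [n, m, k] then contracts to the edge [n, k]. *)
Lemma gammaM k m n : [set k]%SET \in G -> [set m]%SET \in G ->
  [set n]%SET \in G -> ([set k; m; n] \in N)%SET ->
  (gamma N G m0 k m * gamma N G m0 m n)%g = gamma N G m0 k n.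
Proof.
move=> kG mG nG kmn; have [km mn kn] := edge_triangle kmn.
move: km mn kn; rewrite edge_sym => /(gamma_word_loop kG mG) hkm.
rewrite edge_sym => /(gamma_word_loop mG nG) hmn.
rewrite edge_sym => /(gamma_word_loop kG nG) hkn.
rewrite (gammaE hkm) (gammaE hmn) (gammaE hkn).
apply: etrans (pi1_mulE _ _) _; apply/eqP/pi1_eqP/hsim_homotopic => /=.
have [pm lm] := tree_pathS mG; have [pn ln] := tree_pathS nG.
have := hsim_forth (sub_path tree_edge pm); rewrite lm => hm.
rewrite /gamma_word -!catA -!cat_cons /= -[m :: _ ++ _]/((m :: _) ++ _).
rewrite -!cat_cons.
have := hsim_ctx (m0 :: tree_path G m0 n)
  (k :: rev (belast m0 (tree_path G m0 k))) hm.
rewrite (_ : (m :: _ ++ _) ++ _ = (m :: rev (belast m0 (tree_path G m0 m))) ++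
    tree_path G m0 m ++ k :: rev (belast m0 (tree_path G m0 k))); last first.
  by rewrite /= -catA.
move=> {}hm; apply: rst_trans hm _.
rewrite !(lastI m0 (tree_path _ _ n)) ln !cat_rcons; apply: hsim_tri.
by rewrite finset.setUC [X in (_ :|: X)%SET]finset.setUC finset.setUA.
Qed.

End Homotopy.
End Graphs.

(** * Nerves of covers of connected spaces *)

Section Nerve.
Variables (T : topologicalType) (I : finType).
Implicit Types (U V : I -> set T) (S : {set I}).

Lemma nerve_complex U : simplicial_complex (nerve U).
Proof.
split=> [|S S']; first by rewrite inE eqxx.
rewrite !inE => /andP[_ /asboolP[x Sx]] /fintype.subsetP SS' -> /=.
by apply/asboolP; exists x => m /SS'; exact: Sx.
Qed.

Lemma nerve1P U m : reflect (U m !=set0) ([set m]%SET \in nerve U).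
Proof.
rewrite inE; apply: (iffP andP) => [[_ /asboolP[x h]]|[x h]].
  by exists x; apply: h; rewrite /= inE.
split; first by apply/set0Pn; exists m; rewrite inE.
by apply/asboolP; exists x => k; rewrite /= inE => /eqP ->.
Qed.

Lemma nerve2P U m n : reflect (U m `&` U n !=set0) ([set m; n]%SET \in nerve U).
Proof.
rewrite inE; apply: (iffP andP) => [[_ /asboolP[x h]]|[x [h h']]].
  by exists x; split; apply: h; rewrite /= !inE eqxx ?orbT.
split; first by apply/set0Pn; exists m; rewrite !inE eqxx.
by apply/asboolP; exists x => k; rewrite /= !inE => /orP[] /eqP ->.
Qed.

Lemma nerve3 U k m n x : U k x -> U m x -> U n x ->
  [set k; m; n]%SET \in nerve U.
Proof.
move=> kx mx nx; rewrite inE; apply/andP; split.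
  by apply/set0Pn; exists k; rewrite !inE eqxx.
by apply/asboolP; exists x => l; rewrite /= !inE -orbA => /or3P[] /eqP ->.
Qed.

Lemma nerve3P U k m n : [set k; m; n]%SET \in nerve U ->
  exists x, [/\ U k x, U m x & U n x].
Proof.
rewrite inE => /andP[_ /asboolP[x h]]; exists x.
by split; apply: h; rewrite /= !inE eqxx ?orbT.
Qed.

(** The members joined to [a] in the nerve are disjoint from the others, so their union is open and
    closed in [Y], hence all of [Y]. *)
Lemma nerve_connected (Y : set T) V : connected Y ->
  (forall m, exists2 O, open O & V m = Y `&` O) -> Y = \bigcup_m V m ->
  forall a b, [set a]%SET \in nerve V -> [set b]%SET \in nerve V ->
    connect (adjacent (nerve V)) a b.
Proof.
move=> cY Vo YE a b /nerve1P[x ax] /nerve1P[y b_y].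
have /boolp.choice[O OP] : forall m, exists O, open O /\ V m = Y `&` O.
  by move=> m; have [O ? ?] := Vo m; exists O.
pose near_a m := connect (adjacent (nerve V)) a m.
pose B := \bigcup_(m in [set m | near_a m]) V m.
have step m n z : near_a m -> V m z -> V n z -> near_a n.
  move=> am mz nz; have [<- //|mn] := eqVneq m n.
  apply: connect_trans am (connect1 _); rewrite /adjacent mn /=.
  by apply/nerve2P; exists z.
have BY : B = Y.
  apply: cY.
  - by exists x, a => //; exact: connect0.
  - exists (\bigcup_(m in [set m | near_a m]) O m).
      by apply: bigcup_open => m _; case: (OP m).
    by rewrite setI_bigcupr; apply: eq_bigcupr => m _; case: (OP m).
  - exists (~` \bigcup_(m in [set m | ~~ near_a m]) O m).
      by apply: open_closedC; apply: bigcup_open => m _; case: (OP m).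
    apply/seteqP; split=> z.
      move=> [m am mz]; have Yz : Y z by rewrite YE; exists m.
      split=> // -[n /negP an nz]; apply: an; apply: step am mz _.
      by rewrite (OP n).2.
    move=> [Yz h]; move: (Yz); rewrite YE => -[m _ mz].
    exists m => //=; apply/negPn/negP => am; apply: h; exists m => //.
    by move: mz; rewrite (OP m).2 => -[].
have [m am mz] : B y by rewrite BY YE; exists b.
exact: step am mz b_y.
Qed.

Lemma nerve_spanning (R : realType) (X : set T) U (G : {set {set I}}) :
  connected X -> good_open_cover R X U -> maximal_subtree (skel1 (nerve U)) G ->
  forall m, [set m]%SET \in nerve U -> [set m]%SET \in G.
Proof.
move=> cX [Uo XE _] mG; apply: maximal_subtree_spanning mG.
  exact: nerve_complex.
exact: nerve_connected Uo XE.
Qed.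

End Nerve.
(** * Transport along edge paths *)

Section ConvexCombination.
Variables (R : realType) (A : cstarType R) (E : innerModType A).
Hypothesis hE : pre_hilbert E.

Lemma rscale1 (z : E) : rscale 1 z = z.
Proof. by rewrite /rscale rmorph1 scale1r; exact: scale1r. Qed.

Lemma rscale_suml (J : finType) (c : J -> R) (z : E) :
  \sum_j rscale (c j) z = rscale (\sum_j c j) z.
Proof.
elim/big_rec2: _ => [|j r _ _ ->]; first by rewrite /rscale rmorph0 scale0r;
  exact/esym/scale0r.
by rewrite /rscale -scalerDl rmorphD /= [in RHS]scalerDl.
Qed.

Lemma rscaleBr r (y z : E) : rscale r (y - z) = rscale r y - rscale r z.
Proof. exact: scalerBr. Qed.

Lemma rscaleA r s (z : E) : rscale r (rscale s z) = rscale (r * s) z.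
Proof.
apply: (inner_inj hE) => w; rewrite !inner_rscale /rscale !innerZr.
by rewrite -!scalerAr !mulr1 scalerA -rmorphM /= mulrC.
Qed.

Lemma convex_near (J : finType) (c : J -> R) (f : J -> E) (y : E) (d : R) :
  (forall j, 0 <= c j) -> \sum_j c j = 1 ->
  (forall j, c j != 0 -> hnorm (f j - y) <= d) ->
  hnorm (\sum_j rscale (c j) (f j) - y) <= d.
Proof.
move=> c0 c1 fy; rewrite -{1}(rscale1 y) -c1 -rscale_suml -sumrB.
apply: le_trans (hnorm_sum _ hE) _.
rewrite -[d]mul1r -c1 mulr_suml; apply: ler_sum => j _.
rewrite -rscaleBr hnorm_rscale ger0_norm //.
have [->|cj] := eqVneq (c j) 0; first by rewrite !mul0r.
by rewrite ler_wpM2l ?fy.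
Qed.
End ConvexCombination.

Section Transport.
Variables (R : realType) (T : topologicalType) (I : finType) (U : I -> set T).
Local Notation N := (nerve U).

(** [edge] is reflexive even at indices of empty members, so nonemptiness of [U a] is assumed here
    and carried along paths in [transport_unitary]. *)
Lemma edge_meet a b : U a !=set0 -> edge N a b -> U a `&` U b !=set0.
Proof.
move=> [x ax]; rewrite /edge => /orP[/eqP <-|/nerve2P //].
by exists x.
Qed.

Lemma meet_sym a b : U a `&` U b !=set0 -> U b `&` U a !=set0.
Proof. by rewrite setIC. Qed.

Section Flat.
Variables (A : cstarType R) (E : innerModType A) (pt : I -> I -> T).
Variables (v : cochain T I E) (eps : R).
Hypotheses (hE : pre_hilbert E) (hpt : chosen_points U pt).
Hypotheses (eps0 : 0 <= eps) (hv : flat_bundle U eps v).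

Lemma flat_unitary m n x : U m x -> U n x -> unitary (v m n x).
Proof. by case: hv => h _ _ _ mx nx; exact: h. Qed.

Lemma flat_diag m x z : U m x -> v m m x z = z.
Proof.
case: hv => h1 h2 _ _ mx; apply: unitary_idem; first exact: h1.
exact: h2.
Qed.

Lemma flat_near m n x y : U m x -> U n x -> U m y -> U n y ->
  op_near eps (v m n x) (v m n y).
Proof.
by case: hv => _ _ _ h mx nx my ny; apply: opnorm_near => //; exact: h.
Qed.

Lemma transport_cat a p q : transport pt v a (p ++ q) =
  transport pt v (last a p) q ** transport pt v a p.
Proof.
elim: p a => [|b p IH] a /=; first by rewrite opM1.
by rewrite IH opcompA.
Qed.

Lemma pt_meet a b : U a `&` U b !=set0 ->
  U a (pt a b) /\ U b (pt a b).
Proof. by move=> /hpt[_ []]. Qed.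

Lemma transport_unitary a p : U a !=set0 -> path (edge N) a p ->
  unitary (transport pt v a p) /\ U (last a p) !=set0.
Proof.
elim: p a => [|b p IH] a Ua /=; first by split=> //; exact: unitary1.
move=> /andP[/(edge_meet Ua)/meet_sym ab bp].
have [bx ax] := pt_meet ab.
have [ub lb] := IH b (ex_intro _ _ bx) bp.
by split=> //; apply: unitary_comp => //; exact: flat_unitary.
Qed.

Lemma transport_dup a p : U a !=set0 ->
  op_near 0 (transport pt v a (a :: p)) (transport pt v a p).
Proof.
move=> [x ax] z /=; have [aa _] := pt_meet (ex_intro _ x (conj ax ax)).
by rewrite flat_diag // subrr hnorm0 mul0r.
Qed.

(** Two [eps] move the factors [v c b] and [v b a] from their sample points to a common point, where
    the cocycle identity is exact; the third moves [v c a] to its sample point. *)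
Lemma transport_triangle a b c p : [set a; b; c]%SET \in N ->
  path (edge N) c p ->
  op_near (eps + (eps + eps)) (transport pt v a [:: b, c & p])
    (transport pt v a (c :: p)).
Proof.
move=> abc cp; have [x [ax bx cx]] := nerve3P abc.
have [cb1 cb2] := pt_meet (ex_intro _ x (conj cx bx)).
have [ba1 ba2] := pt_meet (ex_intro _ x (conj bx ax)).
have [ca1 ca2] := pt_meet (ex_intro _ x (conj cx ax)).
have [up _] := transport_unitary (ex_intro _ x cx) cp.
rewrite /= -opcompA; have cr := unitary_contraction up.
have ctr m n y : U m y -> U n y -> op_contraction (v m n y).
  by move=> my ny; apply: unitary_contraction; exact: flat_unitary.
have vE : v c b x ** v b a x = v c a x by case: hv => _ h _ _; exact: h.
have n1 : op_near (eps + eps) (v c b (pt c b) ** v b a (pt b a)) (v c a x).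
  rewrite -vE; apply: (near_comp hE (ctr _ _ _ cb1 cb2) (ctr _ _ _ bx ax) eps0);
    exact: flat_near.
have n2 : op_near (eps + (eps + eps)) (v c b (pt c b) ** v b a (pt b a))
    (v c a (pt c a)).
  by rewrite [eps + (eps + eps)]addrC; apply: (near_trans hE n1);
    exact: flat_near.
rewrite -[X in op_near X]addr0.
by apply: (near_comp hE cr (ctr _ _ _ ca1 ca2) (lexx 0) (near_refl _ (lexx 0))
  n2).
Qed.

End Flat.

Lemma split_word (m0 a : I) (s r p : seq I) : m0 :: p = s ++ a :: r ->
  exists2 u, p = u ++ r & last m0 u = a /\ m0 :: u = rcons s a.
Proof.
case: s => [|x s] [-> ->]; first by exists [::].
by exists (rcons s a); rewrite ?cat_rcons ?last_rcons.
Qed.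

(** The algebra, the module, the sample points, the bundle and [eps] are quantified inside, so that
    [k] depends only on the cover and the two paths. *)
Definition transport_close (k : nat) m0 (p q : seq I) : Prop :=
  forall (A : cstarType R) (E : innerModType A) pt (v : cochain T I E) eps,
    pre_hilbert E -> chosen_points U pt -> 0 <= eps -> flat_bundle U eps v ->
    op_near (k%:R * eps) (transport pt v m0 p) (transport pt v m0 q).

Lemma transport_close_le k l m0 p q : (k <= l)%N ->
  transport_close k m0 p q -> transport_close l m0 p q.
Proof.
move=> kl h A E pt v eps hE hpt e0 hv;
  apply: near_le (h _ _ _ _ _ hE hpt e0 hv).
by rewrite ler_wpM2r // ler_nat.
Qed.

(** Transport along the common initial and final segments is unitary and does not enlarge the local
    error, which is 0 for a repeated vertex and three [eps] for a triangle. *)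
Lemma elem_homotopy_close m0 (p q : loop N m0) : U m0 !=set0 ->
  elem_homotopy p q -> transport_close 3 m0 (val p) (val q).
Proof.
move=> Um0 h A E pt v eps hE hpt e0 hv.
have eE : 3%:R * eps = eps + (eps + eps) by ring.
have e3 : 0 <= 3%:R * eps by rewrite mulr_ge0.
have /andP[pp _] := valP p; have /andP[qp _] := valP q.
case: h => [[s [t [a [pE qE]]]]|[s [t [a [b [c [abc pE qE]]]]]]].
  have [u pE' [la uE]] := split_word pE.
  have qE' : val q = u ++ t by move: qE; rewrite -cat_rcons -uE => -[].
  move: qp; rewrite qE' cat_path => /andP[uq _].
  have [uu lu] := transport_unitary hpt hv Um0 uq.
  move: pp; rewrite pE' cat_path la => /andP[_ ap]; rewrite la in lu.
  have [up _] := transport_unitary hpt hv lu ap.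
  rewrite !(transport_cat pt v) la -[X in op_near X]add0r.
  apply: (near_comp hE (unitary_contraction up) (unitary_contraction uu) e3).
    by apply: (near_le e3); apply: (transport_dup hpt hv).
  exact: near_refl.
have [u pE' [la uE]] := split_word pE.
have qE' : val q = u ++ c :: t by move: qE; rewrite -cat_rcons -uE => -[].
move: qp; rewrite qE' cat_path => /andP[uq cp]; have /andP[_ ct] := cp.
have [uu lu] := transport_unitary hpt hv Um0 uq.
move: pp; rewrite pE' cat_path la => /andP[_ ap]; rewrite la in lu.
have [up _] := transport_unitary hpt hv lu ap.
rewrite !(transport_cat pt v) la -[X in op_near X]add0r.
apply: (near_comp hE (unitary_contraction up) (unitary_contraction uu) e3).
  by rewrite eE; exact: transport_triangle.
exact: near_refl.
Qed.

Lemma homotopic_close m0 (p q : loop N m0) : U m0 !=set0 -> homotopic p q ->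
  exists k, transport_close k m0 (val p) (val q).
Proof.
move=> Um0; elim=> [{}p {}q h|{}p|{}p {}q _ [k h]|{}p {}q r _ [k h] _ [l h']].
- by exists 3%N; exact: elem_homotopy_close.
- exists 0%N => A E pt v eps *; apply: near_refl; by rewrite mul0r.
- exists k => A E pt v eps hE *; exact/near_sym/h.
- exists (k + l)%N => A E pt v eps hE *; rewrite natrD mulrDl.
  by apply: (near_trans hE); [apply: h|apply: h'].
Qed.

(** A maximum over the finite type of all [(G, m0, e, oe)], so that it precedes the choice of the
    tree. [None] stands for the constant loop, needed when a class is trivial; tuples that give no
    homotopic loops contribute 0. *)
Lemma homotopic_close_bound : exists K : nat,
  forall (G : {set {set I}}) m0 (e : I * I) (oe : option (I * I)),
    U m0 !=set0 ->
    let p := gamma_word m0 G e.1 e.2 in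
    let q := if oe is Some e' then gamma_word m0 G e'.1 e'.2 else [::] in
    forall (hp : is_loop N m0 p) (hq : is_loop N m0 q),
    homotopic (Sub p hp : loop N m0) (Sub q hq) -> transport_close K m0 p q.
Proof.
pose J := ({set {set I}} * I * (I * I) * option (I * I))%type.
pose P (j : J) k := let: (G, m0, e, oe) := j in U m0 !=set0 ->
    let p := gamma_word m0 G e.1 e.2 in
    let q := if oe is Some e' then gamma_word m0 G e'.1 e'.2 else [::] in
    forall (hp : is_loop N m0 p) (hq : is_loop N m0 q),
    homotopic (Sub p hp : loop N m0) (Sub q hq) -> transport_close k m0 p q.
have /fin_all_exists[f fP] : forall j, exists k, P j k.
  move=> [[[G m0] e] oe]; rewrite /P.
  set p := gamma_word _ _ _ _; set q := if oe is Some _ then _ else _.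
  have [[Um0 [hp [hq h]]]|no] := pselect (U m0 !=set0 /\ exists
      (hp : is_loop N m0 p) (hq : is_loop N m0 q),
      homotopic (Sub p hp : loop N m0) (Sub q hq)).
    by have [k] := homotopic_close Um0 h; exists k.
  exists 0%N => Um0 hp hq h; exfalso; apply: no; split=> //.
  by exists hp, hq.
exists (\max_j f j) => G m0 e oe Um0 p q hp hq h.
apply: transport_close_le (leq_bigmax (G, m0, e, oe)) _.
exact: (fP (G, m0, e, oe)).
Qed.

End Transport.

(** * From bundles to quasi-representations *)

Section Alpha.
Variables (R : realType) (T : topologicalType) (I : finType) (U : I -> set T).
Local Notation N := (nerve U).
Variables (G : {set {set I}}) (m0 : I) (pt : I -> I -> T).
Hypotheses (tG : is_tree G) (GN : G \subset skel1 N).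
Hypothesis spanG : forall m, [set m]%SET \in N -> [set m]%SET \in G.
Hypothesis Um0 : U m0 !=set0.
Hypothesis hpt : chosen_points U pt.

Let cN : simplicial_complex N := nerve_complex U.

Lemma vertexG m x : U m x -> [set m]%SET \in G.
Proof. by move=> mx; apply/spanG/nerve1P; exists x. Qed.

Let m0G : [set m0]%SET \in G.
Proof. by have [x] := Um0; exact: vertexG. Qed.

Lemma meet_edge m n x : U m x -> U n x -> edge N m n.
Proof.
by move=> mx nx; apply/orP; right; apply/nerve2P; exists x.
Qed.

Lemma tree_meet a b : adjacent G a b -> U a `&` U b !=set0.
Proof.
by move=> /andP[_ /(fintype.subsetP GN)]; rewrite inE => /andP[/nerve2P].
Qed.

Lemma gamma_cases m n x : U m x -> U n x -> gamma N G m0 m n = 1%g \/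
  off_tree N G (m, n).
Proof.
move=> mx nx; have [->|mn] := eqVneq m n.
  by left; exact: gamma_diag (vertexG nx).
have [mnG|mnG] := boolP ([set m; n]%SET \in G).
  by left; apply: gamma_tree => //; rewrite /adjacent mn.
right; rewrite /off_tree /adjacent /= mn mnG andbT.
by apply/nerve2P; exists x.
Qed.

Lemma gamma_generator m n x : U m x -> U n x ->
  gamma N G m0 m n = 1%g \/ generators N G m0 (gamma N G m0 m n).
Proof.
move=> mx nx; have [->|off] := gamma_cases mx nx; first by left.
by right; exists (m, n).
Qed.

Lemma off_tree_meet e : off_tree N G e -> U e.1 `&` U e.2 !=set0.
Proof. by move=> /andP[/andP[_ /nerve2P]]. Qed.

Section Tame.
Variables (A : cstarType R) (E : innerModType A).
Hypothesis hE : pre_hilbert E.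
Implicit Types (v : cochain T I E) (eps : R).

(** The common ground of normalized flat bundles and of [beta rho], sufficient for estimating
    [alpha] on generators. *)
Definition tame eps v : Prop :=
  (forall m n x, U m x -> U n x -> op_contraction (v m n x)) /\
  (forall m n x, adjacent G m n -> U m x -> U n x ->
     op_near eps (v m n x) (op1 E)).

Lemma flat_tame eps v : flat_bundle U eps v -> normalized U G eps v ->
  tame eps v.
Proof.
move=> hv nv; split=> m n x.
  by move=> mx nx; apply: unitary_contraction; exact: (flat_unitary hv).
by move=> mn mx nx; apply: opnorm_near => //; exact: nv.
Qed.

Lemma tree_transport eps v a p : 0 <= eps -> tame eps v ->
  path (adjacent G) a p ->
  op_contraction (transport pt v a p) /\
  op_near ((size p)%:R * eps) (transport pt v a p) (op1 E).
Proof.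
move=> e0 [cv nv]; elim: p a => [|b p IH] a /=.
  by move=> _; split=> //; apply: near_refl; rewrite mul0r.
move=> /andP[ab /IH[cb nb]]; have [_ [bx ax]] := hpt (meet_sym (tree_meet ab)).
have cba := cv _ _ _ bx ax; split; first exact: op_contraction_comp.
have -> : (size p).+1%:R * eps = eps + (size p)%:R * eps.
  by rewrite -addn1 natrD mulrDl mul1r addrC.
apply: (near_comp (S' := op1 E) (T' := op1 E) hE cb) => //.
  by rewrite mulr_ge0.
by apply: nv; rewrite // adjacent_sym.
Qed.

Lemma tree_path_transport eps v m x : 0 <= eps -> tame eps v -> U m x ->
  op_contraction (transport pt v m0 (tree_path G m0 m)) /\
  op_near (#|I|%:R * eps) (transport pt v m0 (tree_path G m0 m)) (op1 E).
Proof.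
move=> e0 tv mx; have mP := tree_pathP tG m0G (vertexG mx).
have [pm _] := tree_pathS tG m0G (vertexG mx).
have [c n] := tree_transport e0 tv pm; split=> //; apply: near_le n.
by rewrite ler_wpM2r // ler_nat ltnW // (tree_path_size mP).
Qed.

Variable tau : pi1 N m0 -> free_group N G.
Hypothesis htau : good_section tau.

Lemma alpha1 v : alpha pt tau v 1%g = op1 E.
Proof. by rewrite /alpha; have [_ -> _] := htau; rewrite big_nil. Qed.

(** The edge [e] is the one selected by [tau], the same for all [v]. The two tree transports around
    [v e.1 e.2] are each within [#|I| * eps] of the identity. *)
Lemma alpha_letter g : generators N G m0 g -> g <> 1%g ->
  exists2 e, off_tree N G e & gamma N G m0 e.1 e.2 = g /\
    forall eps v, 0 <= eps -> tame eps v ->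
    op_near ((#|I| + #|I|)%:R * eps) (alpha pt tau v g)
      (v e.1 e.2 (pt e.1 e.2)).
Proof.
have [_ _ h] := htau; move=> gg g1; have [e [off eE tE]] := h g gg g1.
exists e => //; split=> // eps v e0 tv.
have /hpt[_ [ex1 ex2]] := off_tree_meet off.
have [c1 n1] := tree_path_transport e0 tv ex1.
have [c2 n2] := tree_path_transport e0 tv ex2.
rewrite /alpha tE big_seq1.
have w0 : 0 <= #|I|%:R * eps by rewrite mulr_ge0.
have n1' := near_adj hE hE w0 n1.
have ce := tv.1 _ _ _ ex1 ex2; have c1' := op_contraction_adj hE hE c1.
rewrite natrD mulrDl.
have := near_comp (S' := v e.1 e.2 (pt e.1 e.2)) (T' := op1 E) hE
  (op_contraction_comp c1' ce) (@op_contraction1 _ _ _) w0 _ n2.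
rewrite opM1; apply; rewrite -[X in op_near X]add0r.
rewrite -{2}[v e.1 e.2 _](op1M _).
apply: near_comp => //; last exact: near_refl.
Qed.

Lemma alpha_unitary eps v g : flat_bundle U eps v -> unitary (alpha pt tau v g).
Proof.
move=> hv; rewrite /alpha; case: (tau g) => w /= /andP[aw _].
elim: w aw => [|e w IH] /=; first by move=> _; rewrite big_nil; exact: unitary1.
move=> /andP[off /IH uw]; rewrite big_cons; apply: unitary_comp => //.
have /hpt[_ [ex1 ex2]] := off_tree_meet off.
have u m x : U m x -> unitary (transport pt v m0 (tree_path G m0 m)).
  move=> mx; have [pm _] := tree_pathS tG m0G (vertexG mx).
  by have [] := transport_unitary hpt hv Um0 (sub_path (tree_edge GN) pm).
apply: unitary_comp; last exact: u ex2.
apply: unitary_comp; first exact/unitary_adj/(u _ _ ex1).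
exact: (flat_unitary hv).
Qed.

(** The tree paths out and back cost [#|I| * eps] each, and one more [eps] moves [v m n] from the
    sample point to [x]. *)
Lemma gamma_word_near eps v m n x : 0 <= eps -> flat_bundle U eps v ->
  normalized U G eps v -> U m x -> U n x ->
  op_near ((#|I| + #|I|).+1%:R * eps)
    (transport pt v m0 (gamma_word m0 G m n)) (v m n x).
Proof.
move=> e0 hv nv mx nx; have tv := flat_tame hv nv.
have /hpt[_ [mp np]] : U m `&` U n !=set0 by exists x.
have [pm lm] := tree_pathS tG m0G (vertexG mx).
have [_ ln] := tree_pathS tG m0G (vertexG nx).
have sm := tree_path_size (tree_pathP tG m0G (vertexG mx)).
have [cn nn] := tree_path_transport e0 tv nx.
have pm' : path (adjacent G) m (rev (belast m0 (tree_path G m0 m))).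
  rewrite -{1}lm rev_path (eq_path (e' := adjacent G)) // => a b.
  exact: adjacent_sym.
have [cm] := tree_transport e0 tv pm'; rewrite size_rev size_belast => nm.
have w0 : 0 <= #|I|%:R * eps by rewrite mulr_ge0.
have {}nm : op_near (#|I|%:R * eps)
    (transport pt v m (rev (belast m0 (tree_path G m0 m)))) (op1 E).
  by apply: near_le nm; rewrite ler_wpM2r // ler_nat ltnW.
rewrite /gamma_word transport_cat ln /=.
have cmn := tv.1 _ _ _ mp np.
rewrite -addn1 natrD mulrDl mul1r natrD mulrDl.
apply: (near_trans hE (T := v m n (pt m n))); last exact: (flat_near hE hv).
have := near_comp (S' := v m n (pt m n)) (T' := op1 E) hE
  (op_contraction_comp cm cmn) (@op_contraction1 _ _ _) w0 _ nn.
rewrite opM1; apply; rewrite -[X in op_near X]add0r.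
rewrite -{2}[v m n _](op1M _).
apply: near_comp => //; last exact: near_refl.
Qed.

Variable K : nat.
Hypothesis hK : forall e oe,
    let p := gamma_word m0 G e.1 e.2 in
    let q := if oe is Some e' then gamma_word m0 G e'.1 e'.2 else [::] in
    forall (hp : is_loop N m0 p) (hq : is_loop N m0 q),
    homotopic (Sub p hp : loop N m0) (Sub q hq) ->
    transport_close R U K m0 p q.

(** If [tau] selects [e] for the class of [(m, n)], the comparison passes from [alpha] to [v] at
    [e], to transport along the loop of [e], to transport along the loop of [(m, n)], to [v m n x].
    The costs are [2 #|I|], [2 #|I| + 1], [K] and [2 #|I| + 1] times [eps]. *)
Lemma alpha_gamma_near eps v m n x : 0 <= eps -> flat_bundle U eps v ->
  normalized U G eps v -> U m x -> U n x ->
  op_near ((K + 6 * #|I| + 2)%:R * eps) (alpha pt tau v (gamma N G m0 m n))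
    (v m n x).
Proof.
move=> e0 hv nv mx nx; have tv := flat_tame hv nv.
have hmn := gamma_word_loop tG GN m0G (vertexG mx) (vertexG nx)
  (meet_edge nx mx).
have Lmn := gamma_word_near e0 hv nv mx nx.
(* The class may be trivial even for an edge outside the tree. There [alpha] is the identity, and
   the loop is compared with the constant one. *)
have [g1|g1] := pselect (gamma N G m0 m n = 1%g).
  have h0 : is_loop N m0 [::] := valP (loop_id N m0).
  have h : homotopic (Sub _ hmn : loop N m0) (Sub _ h0).
    apply/pi1_eqP; rewrite -(gammaE hmn) g1; apply/eqP.
    by congr (\pi_(pi1 N m0)%qT _); apply: val_inj.
  have := @hK (m, n) None hmn h0 h A E pt v eps hE hpt e0 hv => /near_sym LK.
  rewrite g1 alpha1; apply: near_le (near_trans hE LK Lmn).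
  by rewrite -mulrDl ler_wpM2r // -natrD ler_nat; lia.
have [//|gg] := gamma_generator mx nx.
have [e off [eE /(_ _ _ e0 tv) le]] := alpha_letter gg g1.
have /hpt[_ [ex1 ex2]] := off_tree_meet off.
have he := gamma_word_loop tG GN m0G (vertexG ex1) (vertexG ex2)
  (meet_edge ex2 ex1).
have Le := near_sym (gamma_word_near e0 hv nv ex1 ex2).
have h : homotopic (Sub _ he : loop N m0) (Sub _ hmn).
  by apply/pi1_eqP; rewrite -(gammaE hmn) -(gammaE he) eE.
have LK := @hK e (Some (m, n)) he hmn h A E pt v eps hE hpt e0 hv.
apply: near_le (near_trans hE le (near_trans hE Le (near_trans hE LK Lmn))).
by rewrite -!mulrDl ler_wpM2r // -!natrD ler_nat; lia.
Qed.

End Tame.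
End Alpha.
(** * Comparison of bundles and quasi-representations *)

Section SupNorm.
Variable R : realType.
Implicit Types (S : set (\bar R)) (b r : \bar R).
Local Open Scope ereal_scope.

Lemma sup_norm_le S b : 0 <= b -> (forall r, S r -> r <= b) -> sup_norm S <= b.
Proof. by move=> b0 Sb; apply: ge_ereal_sup => r [->|/Sb]. Qed.

Lemma sup_norm_ub S r : S r -> r <= sup_norm S.
Proof. by move=> Sr; apply: ereal_sup_ubound; right. Qed.

Lemma sup_norm_ge0 S : 0 <= sup_norm S.
Proof. by apply: ereal_sup_ubound; left. Qed.

Lemma lee_shift (a b b' : \bar R) (c c' : R) : a <= b + c%:E -> b <= b' ->
  (c <= c')%R -> a <= b' + c'%:E.
Proof.
by move=> ab bb cc; apply: le_trans ab _; apply: leeD; rewrite ?lee_fin.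
Qed.

End SupNorm.

(** * From quasi-representations to bundles, and the two composites *)

Section Beta.
Variables (R : realType) (T : topologicalType) (I : finType) (U : I -> set T).
Local Notation N := (nerve U).
Variables (G : {set {set I}}) (m0 : I) (pt : I -> I -> T) (eta : I -> T -> R).
Hypotheses (tG : is_tree G) (GN : G \subset skel1 N).
Hypothesis spanG : forall m, [set m]%SET \in N -> [set m]%SET \in G.
Hypothesis Um0 : U m0 !=set0.
Hypothesis hpt : chosen_points U pt.
Hypothesis eta_supp : forall k m x, U m x -> eta k x != 0 -> U k x.
Hypothesis eta_sum : forall m x, U m x -> \sum_k eta k x ^+ 2 = 1.

Let cN : simplicial_complex N := nerve_complex U.

Let vG m x : U m x -> [set m]%SET \in G.
Proof. exact: vertexG. Qed.

Let m0G : [set m0]%SET \in G.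
Proof. by have [x] := Um0; exact: vG. Qed.

Variables (A : cstarType R) (E : innerModType A).
Hypothesis hE : pre_hilbert E.
Implicit Types (v : cochain T I E) (rho : pi1 N m0 -> adjop E E) (eps : R).

Lemma psi_inner rho m n x z : ((psi G eta rho m x)^adj ** psi G eta rho n x) z =
  \sum_k rscale (eta k x ^+ 2)
    (opadj (rho (gamma N G m0 k m)) (rho (gamma N G m0 k n) z)).
Proof.
rewrite /= ; apply: eq_bigr => k _; rewrite ffunE rscaleA //.
by rewrite opadj_rscale.
Qed.

(* Unitarity of [rho] makes [psi] isometric, so the inverse roots in [beta]
   are trivial. *)
Lemma beta_sum rho m n x z : (forall g, unitary (rho g)) -> U m x -> U n x ->
  beta G eta rho m n x z = \sum_k rscale (eta k x ^+ 2)
    (opadj (rho (gamma N G m0 k m)) (rho (gamma N G m0 k n) z)).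
Proof.
move=> ur mx nx.
have iso k : U k x -> (psi G eta rho k x)^adj ** psi G eta rho k x = op1 E.
  move=> kx; have e y : ((psi G eta rho k x)^adj ** psi G eta rho k x) y = y.
    rewrite psi_inner; under eq_bigr do rewrite unitary_adjK //.
    by rewrite rscale_suml (eta_sum kx) rscale1.
  by apply: adjop_eq => y; exact: e.
rewrite -psi_inner /beta (iso m mx) (iso n nx) /=.
by rewrite [inv_sqrt _ z]inv_sqrt1 // inv_sqrt1.
Qed.

Lemma beta_near rho c (w : adjop E E) m n x : 
  (forall g, unitary (rho g)) -> U m x -> U n x ->
  (forall k, U k x -> op_near c
    ((rho (gamma N G m0 k m))^adj ** rho (gamma N G m0 k n)) w) ->
  op_near c (beta G eta rho m n x) w.
Proof.
move=> ur mx nx h z; rewrite beta_sum //; apply: convex_near => //.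
- by move=> k; exact: sqr_ge0.
- exact: eta_sum mx.
- by move=> k; rewrite sqrf_eq0 => /(eta_supp mx)/h; exact.
Qed.

Lemma beta_contraction rho m n x : (forall g, unitary (rho g)) ->
  U m x -> U n x -> op_contraction (beta G eta rho m n x).
Proof.
move=> ur mx nx z; rewrite beta_sum //.
rewrite -[X in hnorm X]subr0; apply: convex_near => //.
- by move=> k; exact: sqr_ge0.
- exact: eta_sum mx.
- move=> k _; rewrite subr0 -/((rho (gamma N G m0 k m))^adj _).
  apply: le_trans (unitary_contraction (unitary_adj (ur _)) _) _.
  exact: unitary_contraction.
Qed.

(** Quasi-multiplicativity is given on generators only; a class [gamma] that is not a generator is
    trivial, and then [rho 1 = 1] makes the relation exact. *)
Lemma quasi_rep_gammaM eps rho k m n x : 0 <= eps -> quasi_rep G eps rho ->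
  U k x -> U m x -> U n x ->
  op_near eps (rho (gamma N G m0 k m) ** rho (gamma N G m0 m n))
    (rho (gamma N G m0 k n)).
Proof.
move=> e0 [ur r1 rM] kx mx nx.
rewrite -(gammaM cN tG GN m0G (vG kx) (vG mx) (vG nx) (nerve3 kx mx nx)).
have [->|gk] := gamma_generator tG GN spanG Um0 kx mx.
  by rewrite r1 mul1g op1M; exact: near_refl.
have [->|gm] := gamma_generator tG GN spanG Um0 mx nx.
  by rewrite r1 mulg1 opM1; exact: near_refl.
by apply: opnorm_near => //; exact: rM.
Qed.

Lemma beta_quasi_rep_near eps rho m n x : 0 <= eps -> quasi_rep G eps rho ->
  U m x -> U n x ->
  op_near eps (beta G eta rho m n x) (rho (gamma N G m0 m n)).
Proof.
move=> e0 hr mx nx; have [ur _ _] := hr; apply: beta_near => // k kx z /=.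
have := quasi_rep_gammaM e0 hr kx mx nx z => /=.
set g := rho (gamma N G m0 k m); set y := rho (gamma N G m0 m n) z => h.
(* The unitary [rho (gamma k m)] is moved to the other side, which turns the averaged term into the
   defect of multiplicativity. *)
rewrite -[X in _ - X](unitary_adjK _ (ur (gamma N G m0 k m))) -/g -opadjB //.
apply: le_trans (unitary_contraction (unitary_adj (ur _)) _) _.
by rewrite hnorm_distC.
Qed.

Lemma beta_tame eps rho : 0 <= eps -> quasi_rep G eps rho ->
  tame U G eps (beta G eta rho).
Proof.
move=> e0 hr; have [ur r1 _] := hr.
split=> m n x; first exact: beta_contraction.
move=> mn mx nx; rewrite -r1 -(gamma_tree cN tG GN m0G mn).
exact: beta_quasi_rep_near.
Qed.

Lemma dist_beta eps rho rho' : 0 <= eps -> quasi_rep G eps rho ->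
  quasi_rep G eps rho' ->
  (dist_cochain U (beta G eta rho) (beta G eta rho') <=
   dist_rep G rho rho' + (2%:R * eps)%:E)%E.
Proof.
move=> e0 hr hr'; have e2 : 0 <= 2%:R * eps by rewrite mulr_ge0.
apply: sup_norm_le; first by rewrite adde_ge0 ?sup_norm_ge0.
move=> _ [m [n [x [[mx nx] ->]]]].
have := opnorm_near_le hE e0 e0 (beta_quasi_rep_near e0 hr mx nx)
  (beta_quasi_rep_near e0 hr' mx nx).
rewrite (_ : eps + eps = 2%:R * eps); last by ring.
move=> /le_trans; apply; apply: leeD2r.
(* A trivial class need not occur in the supremum defining [dist_rep], but there both
   quasi-representations are the identity. *)
have [->|gg] := gamma_generator tG GN spanG Um0 mx nx; last first.
  by apply: sup_norm_ub; exists (gamma N G m0 m n).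
apply: le_trans (sup_norm_ge0 _).
have [[_ -> _] [_ -> _]] := (hr, hr').
by apply: near_opnorm => //; exact: near_refl.
Qed.

Variable tau : pi1 N m0 -> free_group N G.
Hypothesis htau : good_section tau.

Lemma dist_alpha_beta eps rho : 0 <= eps -> quasi_rep G eps rho ->
  (dist_rep G (alpha pt tau (beta G eta rho)) rho <=
   ((#|I| + #|I| + 1)%:R * eps)%:E)%E.
Proof.
move=> e0 hr; have c0 : 0 <= (#|I| + #|I| + 1)%:R * eps by rewrite mulr_ge0.
apply: sup_norm_le; first by rewrite lee_fin.
move=> _ [g gg <-]; apply: near_opnorm => //.
have [->|g1] := pselect (g = 1%g).
  by rewrite alpha1 //; have [_ -> _] := hr; exact: near_refl.
have [e off [eE /(_ _ _ e0 (beta_tame e0 hr))]] :=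
  alpha_letter tG GN spanG Um0 hpt hE htau gg g1.
move=> /(near_trans hE) h; rewrite natrD mulrDl mul1r; apply: h.
have [_ [ex1 ex2]] := hpt (off_tree_meet off).
by rewrite -[in X in op_near _ _ X]eE; exact: beta_quasi_rep_near.
Qed.

(** Both values of [alpha] are within [2 #|I| * eps] of the respective bundles at the same edge and
    the same sample point. *)
Lemma dist_alpha eps v v' : 0 <= eps ->
  flat_bundle U eps v -> normalized U G eps v ->
  flat_bundle U eps v' -> normalized U G eps v' ->
  (dist_rep G (alpha pt tau v) (alpha pt tau v') <=
   dist_cochain U v v' + ((4 * #|I|)%:R * eps)%:E)%E.
Proof.
move=> e0 hv nv hv' nv'.
have tv := flat_tame hE hv nv; have tv' := flat_tame hE hv' nv'.
have c0 : 0 <= (4 * #|I|)%:R * eps by rewrite mulr_ge0.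
have d0 : 0 <= (#|I| + #|I|)%:R * eps by rewrite mulr_ge0.
apply: sup_norm_le; first by rewrite adde_ge0 ?sup_norm_ge0.
move=> _ [g gg <-]; have [->|g1] := pselect (g = 1%g).
  rewrite !alpha1 //; apply: (@le_trans _ _ 0%E).
    by apply: near_opnorm => //; exact: near_refl.
  by rewrite adde_ge0 ?sup_norm_ge0.
have [e off [eE le]] := alpha_letter tG GN spanG Um0 hpt hE htau gg g1.
have := opnorm_near_le hE d0 d0 (le _ _ e0 tv) (le _ _ e0 tv').
rewrite -mulrDl -natrD (_ : (_ + _ = 4 * #|I|)%N); last by lia.
move=> /le_trans; apply; apply: leeD2r; apply: sup_norm_ub.
have [_ h] := hpt (off_tree_meet off).
by exists e.1, e.2, (pt e.1 e.2).
Qed.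

Variable K : nat.
Hypothesis hK : forall e oe,
    let p := gamma_word m0 G e.1 e.2 in
    let q := if oe is Some e' then gamma_word m0 G e'.1 e'.2 else [::] in
    forall (hp : is_loop N m0 p) (hq : is_loop N m0 q),
    homotopic (Sub p hp : loop N m0) (Sub q hq) ->
    transport_close R U K m0 p q.

Lemma dist_beta_alpha eps v : 0 <= eps ->
  flat_bundle U eps v -> normalized U G eps v ->
  (dist_cochain U (beta G eta (alpha pt tau v)) v <=
   ((2 * (K + 6 * #|I| + 2))%:R * eps)%:E)%E.
Proof.
move=> e0 hv nv; set C := (K + _ + 2)%N.
have C0 : 0 <= C%:R * eps by rewrite mulr_ge0.
apply: sup_norm_le; first by rewrite lee_fin mulr_ge0.
move=> _ [m [n [x [[mx nx] ->]]]]; apply: near_opnorm;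
  first by rewrite mulr_ge0.
have ua g : unitary (alpha pt tau v g).
  exact: (alpha_unitary tG GN spanG Um0 hpt tau g hv).
have near_v k l : U k x -> U l x ->
    op_near (C%:R * eps) (alpha pt tau v (gamma N G m0 k l)) (v k l x).
  exact: (alpha_gamma_near tG GN spanG Um0 hpt hE htau hK e0 hv nv).
apply: beta_near => // k kx.
have uv l l' : U l x -> U l' x ->
  unitary (v l l' x) by exact: (flat_unitary hv).
(* The cocycle identity brings [v m n x] into the form of the terms averaged by [beta]; the two
   factors account for the 2 in the constant. *)
have vE : v m n x = (v k m x)^adj ** v k n x.
  have <- : v k m x ** v m n x = v k n x by case: hv => _ h _ _; exact: h.
  by rewrite opcompA; have [-> _] := uv k m kx mx; rewrite op1M.
rewrite vE mul2n -addnn natrD mulrDl; apply: near_comp => //.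
- exact: unitary_contraction (unitary_adj (ua _)).
- by apply: unitary_contraction; exact: uv.
- by apply: near_adj => //; exact: near_v.
- exact: near_v.
Qed.

End Beta.

(** * Variation of a bundle morphism along the tree *)

Section BundleHom.
Variables (R : realType) (T : topologicalType) (I : finType) (V : I -> set T).
Variables (G : {set {set I}}) (A : cstarType R) (E : innerModType A).
Hypothesis hE : pre_hilbert E.
Hypothesis GV : G \subset skel1 (nerve V).
Variables (w1 w2 : cochain T I E) (u : I -> adjop E E) (eps d : R).
Hypotheses (eps0 : 0 <= eps) (d0 : 0 <= d) (hu : bundle_hom V eps w1 w2 u).
Hypothesis n1 : forall m n x, adjacent G m n -> V m x -> V n x ->
  op_near d (w1 m n x) (op1 E).
Hypothesis n2 : forall m n x, adjacent G m n -> V m x -> V n x ->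
  op_near d (w2 m n x) (op1 E).

(** On a tree edge both cocycles are within [d] of the identity, so the intertwining relation up to
    [eps] compares [u m] with [u n]. *)
Lemma bundle_hom_edge m n : adjacent G m n ->
  op_near (eps + 2%:R * d) (u m) (u n).
Proof.
move=> mn z; have [x [mx nx]] := tree_meet GV mn.
have um : unitary (u m) by apply: hu.1; exists x.
have un : unitary (u n) by apply: hu.1; exists x.
have h : op_near eps (u m ** w1 m n x ** (u n)^adj) (w2 m n x).
  apply: opnorm_near => //; apply: le_lt_trans hu.2; apply: sup_norm_ub.
  by exists m, n, x.
have := h (u n z); rewrite /= unitary_adjK // => h1.
have := n2 mn mx nx (u n z) => /= h2.
have := n1 mn mx nx z => /= h3.
have := unitary_contraction um (w1 m n x z - z); rewrite adjopB // => h4.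
have h5 := unitary_contraction un z.
have h6 := hnormD_sub (u m z) (u m (w1 m n x z)) (u n z) hE.
have h7 := hnormD_sub (u m (w1 m n x z)) (w2 m n x (u n z)) (u n z) hE.
have h8 : hnorm (u m z - u m (w1 m n x z)) = _ := hnorm_distC _ _.
have := ler_wpM2l eps0 h5; have := ler_wpM2l d0 h5.
by lra.
Qed.

Lemma bundle_hom_path a p : path (adjacent G) a p ->
  op_near ((size p)%:R * (eps + 2%:R * d)) (u a) (u (last a p)).
Proof.
elim: p a => [|b p IH] a /=; first by move=> _; apply: near_refl; rewrite mul0r.
move=> /andP[/bundle_hom_edge ab /IH bp].
by rewrite -add1n natrD mulrDl mul1r; apply: (near_trans hE ab).
Qed.

End BundleHom.
Theorem theorem6p12 (R : realType) (n : nat) (K L : {set {set 'I_n}})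
    (I : finType) (U : I -> set 'rV[R]_n) :
  simplicial_complex K -> simplicial_complex L -> L \subset K ->
  let X : set 'rV[R]_n := realization R K in
  let Y : set 'rV[R]_n := realization R L in
  let V := restricted_cover U Y in
  let N := nerve U in
  let M := nerve V in
  connected X -> connected Y ->
  good_open_cover R X U -> good_open_cover R Y V ->
  exists C10 C11 : R, [/\ 0 < C10, 0 < C11 &
  forall (G : {set {set I}}) (m0 : I) (ptX ptY : I -> I -> 'rV[R]_n)
    (eta : I -> 'rV[R]_n -> R)
    (tauX : pi1 N m0 -> free_group N G)
    (tauY : pi1 M m0 -> free_group M (G :&: skel1 M)),
  maximal_subtree (skel1 N) G ->
  maximal_subtree (skel1 M) (G :&: skel1 M) ->
  V m0 !=set0 ->
  chosen_points U ptX -> chosen_points V ptY ->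
  square_partition X U eta ->
  good_section tauX -> good_section tauY ->
  forall (A : cstarType R) (P Q : hilbertModType A),
  fg_projective P -> fg_projective Q ->
  forall eps : R, 0 < eps ->
  let alpha := @rel_alpha R A 'rV[R]_n I P Q U Y G m0 ptX ptY tauX tauY in
  let beta := @rel_beta R A 'rV[R]_n I P Q U Y G m0 eta in
  let dB := @dist_bundle R A 'rV[R]_n I P Q U Y in
  let dR := @dist_rel_rep R A 'rV[R]_n I P Q U Y G m0 in
  (forall b b' : rel_bundle 'rV[R]_n I P Q,
     Bdl U Y G eps b -> Bdl U Y G eps b' ->
     (dR (alpha b) (alpha b') <= dB b b' + (C10 * eps)%:E)%E /\
     (dB (beta (alpha b)) b <= (C11 * eps)%:E)%E) /\
  (forall r r' : rel_rep P Q (pi1 N m0) (pi1 M m0),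
     qRep G eps r -> qRep G eps r' ->
     (dB (beta r) (beta r') <= dR r r' + (C10 * eps)%:E)%E /\
     (dR (alpha (beta r)) r <= (C11 * eps)%:E)%E)].
Proof.
move=> cK cL LK X Y V N M cX cY gU gV.
have YX : Y `<=` X.
  move=> x [x0 x1 xL]; split=> //; exact: (fintype.subsetP LK).
have [K1 hK1] := homotopic_close_bound R U.
have [K2 hK2] := homotopic_close_bound R V.
(* The first constant dominates [4 #|I|] of [dist_alpha] and 2 of [dist_beta]. The second dominates
   [dist_beta_alpha] for both covers, whence [K1 + K2], as well as [2 #|I| + 1] of [dist_alpha_beta]
   and [5 #|I|] for the morphisms. *)
exists (4 * #|I| + 2)%:R, (2 * (K1 + K2 + 6 * #|I| + 2))%:R.
split; [by rewrite ltr0n; lia|by rewrite ltr0n; lia|].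
move=> G m0 ptX ptY eta tauX tauY mG mH [x0 [Ux0 Yx0]] hX hY [_ _ es e1] hsX
  hsY.
move=> A P Q _ _ eps /ltW e0 alpha beta dB dR.
have [tG GN _] := mG; have [tH HM _] := mH.
set H := G :&: skel1 M in tauY mH hsY alpha beta dR tH HM *.
have spG := nerve_spanning cX gU mG; have spH := nerve_spanning cY gV mH.
have Um0 : U m0 !=set0 by exists x0.
have Vm0 : V m0 !=set0 by exists x0.
have UX m x : U m x -> X x.
  by case: gU => _ -> _ mx; exists m.
have suppU k m x : U m x -> eta k x != 0 -> U k x.
  move=> /UX Xx kx; apply: es; split=> //; apply: subset_closure; split=> //.
have suppV k m x : V m x -> eta k x != 0 -> V k x.
  by move=> [mx Yx] kx; split=> //; exact: suppU mx kx.
have sumU m x : U m x -> \sum_k eta k x ^+ 2 = 1 by move=> /UX; exact: e1.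
have sumV m x : V m x -> \sum_k eta k x ^+ 2 = 1.
  by move=> [mx _]; exact: sumU mx.
have hP := hilbert_pre P; have hQ := hilbert_pre Q.
have hPQ := pre_hilbert_pair hP hQ.
have kU := fun e oe => hK1 G m0 e oe Um0.
have kV := fun e oe => hK2 H m0 e oe Vm0.
have cle (c : nat) : (c <= 4 * #|I| + 2)%N ->
    c%:R * eps <= (4 * #|I| + 2)%:R * eps.
  by move=> ?; rewrite ler_wpM2r // ler_nat.
have cle' (c : nat) : (c <= 2 * (K1 + K2 + 6 * #|I| + 2))%N ->
    ((c%:R * eps)%:E <= ((2 * (K1 + K2 + 6 * #|I| + 2))%:R * eps)%:E)%E.
  by move=> ?; rewrite lee_fin ler_wpM2r // ler_nat.
split.
  move=> b b' [[f1 n1] [f2 n2] [f0 nn0] hu] [[f1' n1'] [f2' n2'] [f0' nn0'] _].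
  split.
    rewrite /dR /dist_rel_rep /= !ge_max -!andbA; apply/and4P; split.
    - apply: lee_shift (dist_alpha tG GN spG Um0 hX hP hsX e0 f1 n1 f1' n1') _
      (cle _ _).
        by rewrite /dB /dist_bundle !le_max lexx.
      by lia.
    - apply: lee_shift (dist_alpha tG GN spG Um0 hX hP hsX e0 f2 n2 f2' n2') _
      (cle _ _).
        by rewrite /dB /dist_bundle !le_max lexx !orbT.
      by lia.
    - apply: lee_shift (dist_alpha tH HM spH Vm0 hY hQ hsY e0 f0 nn0 f0' nn0')
      _ (cle _ _).
        by rewrite /dB /dist_bundle !le_max lexx !orbT.
      by lia.
    - apply: (@le_trans _ _ (dB b b')).
        rewrite /dB /dist_bundle !le_max; apply/orP; right; apply/orP; right.
        by apply: sup_norm_ub; exists m0.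
      by rewrite leeDl // lee_fin mulr_ge0.
  rewrite /dB /dist_bundle /= !ge_max -!andbA; apply/and4P; split.
  - apply: le_trans (dist_beta_alpha tG GN spG Um0 hX suppU sumU hP hsX kU e0
    f1 n1) (cle' _ _).
    by lia.
  - apply: le_trans (dist_beta_alpha tG GN spG Um0 hX suppU sumU hP hsX kU e0
    f2 n2) (cle' _ _).
    by lia.
  - apply: le_trans (dist_beta_alpha tH HM spH Vm0 hY suppV sumV hQ hsY kV e0
    f0 nn0) (cle' _ _).
    by lia.
  (* Here the constant family with value [bunu b m0] is compared with [bunu b m], along the tree
     path in [H] from [m0] to [m]. *)
  - apply: sup_norm_le; first by rewrite lee_fin mulr_ge0.
    move=> _ [m [x mx] <-]; apply: near_opnorm; first by rewrite mulr_ge0.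
    have m0H := vertexG spH (conj Ux0 Yx0 : V m0 x0).
    have mP := tree_pathP tH m0H (vertexG spH mx).
    have [pm lm] := tree_pathS tH m0H (vertexG spH mx).
    have d0 : 0 <= eps + eps by rewrite addr_ge0.
    have GH i j : adjacent H i j -> adjacent G i j.
      by move=> /andP[ij]; rewrite !inE => /andP[ijG _]; rewrite /adjacent ij.
    have nsum (v : cochain _ I P) :
        normalized U G eps v -> forall i j y, adjacent H i j -> V i y ->
          V j y ->
        op_near (eps + eps) (opsum (v i j y) (bun0 b i j y)) (op1 (P * Q)%type).
      move=> nv i j y ij [iy Yy] [jy _]; rewrite -opsum1;
        apply: near_opsum => //.
        by apply: opnorm_near => //; apply: nv => //; exact: GH.
      by apply: opnorm_near => //; exact: nn0.
    have := bundle_hom_path hPQ HM e0 d0 hu (nsum _ n1) (nsum _ n2) pm.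
    rewrite lm; apply: near_le.
    (* One [eps] comes from the morphism; each of the two direct sums is within [eps + eps] of the
       identity, one [eps] per summand. *)
    have -> : eps + 2%:R * (eps + eps) = 5%:R * eps by ring.
    rewrite mulrA -natrM ler_wpM2r // ler_nat.
    by have := tree_path_size mP; move: (size _) #|I| => s c; lia.
move=> r r' [q1 q2 q0 _] [q1' q2' q0' _].
split.
  rewrite /dB /dist_bundle /= !ge_max -!andbA; apply/and4P; split.
  - apply: lee_shift (dist_beta tG GN spG Um0 suppU sumU hP e0 q1 q1') _ (cle
    _ _).
      by rewrite /dR /dist_rel_rep !le_max lexx.
    by lia.
  - apply: lee_shift (dist_beta tG GN spG Um0 suppU sumU hP e0 q2 q2') _ (cle
    _ _).
      by rewrite /dR /dist_rel_rep !le_max lexx !orbT.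
    by lia.
  - apply: lee_shift (dist_beta tH HM spH Vm0 suppV sumV hQ e0 q0 q0') _ (cle
    _ _).
      by rewrite /dR /dist_rel_rep !le_max lexx !orbT.
    by lia.
  (* Both families are constant, so every term of the supremum is the distance of the two
     unitaries. *)
  - have ur : (opnorm (repu r - repu r') <= dR r r')%E.
      by rewrite /dR /dist_rel_rep !le_max lexx !orbT.
    have u0 := opnorm_ge0 hPQ (repu r - repu r').
    apply: (@le_trans _ _ (dR r r')); last by rewrite leeDl // lee_fin mulr_ge0.
    by apply: sup_norm_le; [exact: le_trans u0 ur|move=> _ [m _ <-]].
rewrite /dR /dist_rel_rep /= !ge_max -!andbA; apply/and4P; split.
- apply: le_trans (dist_alpha_beta tG GN spG Um0 hX suppU sumU hP hsX e0 q1)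
  (cle' _ _).
  by lia.
- apply: le_trans (dist_alpha_beta tG GN spG Um0 hX suppU sumU hP hsX e0 q2)
  (cle' _ _).
  by lia.
- apply: le_trans (dist_alpha_beta tH HM spH Vm0 hY suppV sumV hQ hsY e0 q0)
  (cle' _ _).
  by lia.
(* The constant family evaluated at [m0] returns the original unitary, so the distance is 0. *)
- apply: near_opnorm; first by rewrite mulr_ge0.
  by apply: near_refl; rewrite mulr_ge0.
Qed.
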